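(* Let $A$ be the completed free graded Lie algebra over $\mathbf{Q}$ on generators $a_0,a_2$ in degree $-1$ and $e$ in degree $0$, made into a DGLA by the differential determined by $$\partial a_0=-\tfrac12[a_0,a_0],\qquad \partial a_2=-\tfrac12[a_2,a_2],\qquad \partial e=(\mathrm{ad}_e)a_2+\sum_{i=0}^\infty\frac{B_i}{i!}(\mathrm{ad}_e)^i(a_2-a_0).$$ Let $B$ be the completed free graded Lie algebra over $\mathbf{Q}$ on generators $a_0,a_1,a_2$ in degree $-1$ and $e_1,e_2$ in degree $0$, made into a DGLA by the differential determined by $\partial a_j=-\tfrac12[a_j,a_j]$ for $j=0,1,2$ and $$\partial e_1=(\mathrm{ad}_{e_1})a_1+\sum_{i=0}^\infty\frac{B_i}{i!}(\mathrm{ad}_{e_1})^i(a_1-a_0),\qquad \partial e_2=(\mathrm{ad}_{e_2})a_2+\sum_{i=0}^\infty\frac{B_i}{i!}(\mathrm{ad}_{e_2})^i(a_2-a_1).$$ Then there is a homomorphism $p\colon A\to B$ respecting the DGLA structure (i.e. a degree-preserving Lie algebra homomorphism commuting with the differentials) for which $p(a_0)=a_0$, $p(a_2)=a_2$, and $p(e)$ is given by the Baker–Campbell–Hausdorff formula on $e_1$ and $e_2$: $$p(e)=\mathrm{BCH}(e_1,e_2)=e_1+e_2+\tfrac12[e_1,e_2]+\tfrac1{12}[e_1,[e_1,e_2]]-\tfrac1{12}[e_2,[e_1,e_2]]+\cdots.$$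
   Context: All vector spaces are over $\mathbf{Q}$. A differential graded Lie algebra (DGLA) is a $\mathbb{Z}$-graded vector space with a bilinear bracket satisfying $|[x,y]|=|x|+|y|$ and a linear map $\partial$ of degree $-1$ with $\partial^2=0$, such that for homogeneous $x,y,z$: (1) $[y,x]=-(-1)^{|x||y|}[x,y]$; (2) $[[x,y],z]=[x,[y,z]]-(-1)^{|x||y|}[y,[x,z]]$; (3) $\partial[x,y]=[\partial x,y]+(-1)^{|x|}[x,\partial y]$. A graded Lie algebra has only the bracket, satisfying (1) and (2). Write $\mathrm{ad}_x(y)=[x,y]$. The Bernoulli numbers $B_i$ are defined by $\frac{x}{\exp(x)-1}=\sum_{n=0}^\infty B_n\frac{x^n}{n!}$. Completion: for a finite set of homogeneous generators, let $L=\bigoplus_{n\ge0}L^{(n)}$ be the free graded Lie algebra on them, where $L^{(n)}$ is spanned by words involving exactly $n$ brackets. The completed free graded Lie algebra has degree-$d$ part $\prod_{n\ge0}L^{(n)}_d$, with the bracket extended in the obvious way; infinite sums are understood with respect to the number of brackets. A derivation as in (3) is determined by its values on the generators, and the differentials given in the claim are the derivations so determined; both square to zero. $\mathrm{BCH}(x,y)$ denotes the Baker–Campbell–Hausdorff series, i.e. the Lie series with $\exp(\mathrm{BCH}(x,y))=\exp(x)\exp(y)$ in the algebra of formal power series in non-commuting variables $x,y$. *)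

(* Defs.v *)
From HB Require Import structures.
From mathcomp Require Import all_boot all_order all_algebra.
From mathcomp Require Import finmap.
From mathcomp Require Import boolp functions.
From mathcomp Require Import monalg.

Set Implicit Arguments.
Unset Strict Implicit.
Unset Printing Implicit Defensive.

Import GRing.Theory.
Local Open Scope ring_scope.
Local Open Scope quotient_scope.

(* [hdeg d x] means that [x] is homogeneous of degree [d]; a Z-graded space is
   the (internal) direct sum of its homogeneous subspaces. *)
HB.mixin Record Lmodule_isGradedLie (L : Type) of GRing.Lmodule rat L := {
  hdeg : int -> L -> Prop;
  lbr : L -> L -> L;
  hdeg0 : forall d, hdeg d 0;
  hdegP : forall d a x y, hdeg d x -> hdeg d y -> hdeg d (a *: x + y);
  hdeg_span : forall x, exists (s : seq int) (c : int -> L),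
    (forall d, hdeg d (c d)) /\ x = \sum_(d <- s) c d;
  hdeg_indep : forall (s : seq int) (c : int -> L), uniq s ->
    (forall d, hdeg d (c d)) -> \sum_(d <- s) c d = 0 ->
    forall d, d \in s -> c d = 0;
  lbr_linearl : forall z, linear (fun x => lbr x z);
  lbr_linearr : forall x, linear (lbr x);
  hdeg_br : forall i j x y, hdeg i x -> hdeg j y -> hdeg (i + j) (lbr x y);
  lbr_anti : forall i j x y, hdeg i x -> hdeg j y ->
    lbr y x = - ((-1) ^ (i * j) *: lbr x y);
  lbr_jacobi : forall i j k x y z, hdeg i x -> hdeg j y -> hdeg k z ->
    lbr (lbr x y) z = lbr x (lbr y z) - (-1) ^ (i * j) *: lbr y (lbr x z)
}.

#[short(type="gradedLieType")]
HB.structure Definition GradedLie :=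
  {L of GRing.Lmodule rat L & Lmodule_isGradedLie L}.

Definition glie_morphism (L M : gradedLieType) (f : L -> M) : Prop :=
  [/\ linear f,
      forall d x, hdeg d x -> hdeg d (f x)
    & forall x y, f (lbr x y) = lbr (f x) (f y)].

Definition dgla_differential (L : gradedLieType) (d : L -> L) : Prop :=
  [/\ linear d,
      forall i x, hdeg i x -> hdeg (i - 1) (d x),
      forall x, d (d x) = 0
    & forall i j x y, hdeg i x -> hdeg j y ->
        d (lbr x y) = lbr (d x) y + (-1) ^ i *: lbr x (d y)].

Definition dgla_morphism (L M : gradedLieType) (dL : L -> L) (dM : M -> M)
    (f : L -> M) : Prop :=
  glie_morphism f /\ forall x, f (dL x) = dM (f x).

(* Locked, like several definitions below, only to keep unification from
   unfolding finitely supported functions and quotients. *)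
HB.lock Definition mono (K : choiceType) (k : K) : {malg rat[K]} := << k >>.

HB.lock Definition mlin (K : choiceType) (V : lmodType rat) (h : K -> V)
  (f : {malg rat[K]}) : V := \sum_(k <- msupp f) f@_k *: h k.

Section LinearExtension.
Variables (K : choiceType) (V : lmodType rat) (h : K -> V).
Local Notation mlin := (mlin h).

Lemma mlinEw (d : {fset K}) (f : {malg rat[K]}) :
  (msupp f `<=` d)%fset -> mlin f = \sum_(k <- d) f@_k *: h k.
Proof.
move=> le; rewrite unlock [LHS](big_fset_incl _ le) => //= x xd /mcoeff_outdom ->.
by rewrite scale0r.
Qed.

Lemma mlinU k : mlin (mono k) = h k.
Proof. by rewrite mono.unlock (mlinEw msuppU_le) big_seq_fset1 mcoeffUU scale1r. Qed.

Lemma mlin_is_linear : linear mlin.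
Proof.
move=> a f g; set E := (msupp f `|` msupp g)%fset.
have le : (msupp (a *: f + g) `<=` E)%fset.
  apply: fsubset_trans (msuppD_le _ _) _.
  by apply: fsetUSS => //; apply: msuppZ_le.
rewrite (mlinEw le) (@mlinEw E f) ?fsubsetUl // (@mlinEw E g) ?fsubsetUr //.
rewrite scaler_sumr -big_split; apply: eq_bigr => k _ /=.
by rewrite mcoeffD mcoeffZ scalerDl scalerA.
Qed.

HB.instance Definition _ :=
  GRing.isLinear.Build rat {malg rat[K]} V _ mlin mlin_is_linear.

End LinearExtension.

Lemma mlin_eq (K : choiceType) (V : lmodType rat) (F : {malg rat[K]} -> V) :
  linear F -> forall f, F f = mlin (fun k => F (mono k)) f.
Proof.
move=> lF f.
pose F' : {linear {malg rat[K]} -> V} :=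
  HB.pack F (GRing.isLinear.Build rat {malg rat[K]} V _ F lF).
rewrite unlock [in LHS](monalgE f) -[F _]/(F' _) linear_sum; apply: eq_bigr => k _ /=.
have -> : << f@_k *g k >> = f@_k *: mono k :> {malg rat[K]}.
  by apply/malgP => k'; rewrite mono.unlock mcoeffZ !mcoeffU mulrnAr mulr1.
by rewrite -[F _]/(F' _) linearZ.
Qed.

Section Support.
Variable K : choiceType.
Implicit Types (P : pred K) (f g : {malg rat[K]}).

Definition supp_in P f : Prop := forall k, k \in msupp f -> P k.

Lemma supp_in0 P : supp_in P 0.
Proof. by move=> k; rewrite msupp0. Qed.

Lemma supp_inP P a f g : supp_in P f -> supp_in P g -> supp_in P (a *: f + g).
Proof.
move=> Pf Pg k; rewrite -mcoeff_neq0 mcoeffD mcoeffZ => nz.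
have [/Pf //|kf] := boolP (k \in msupp f); apply: Pg.
by rewrite -mcoeff_neq0; rewrite mcoeff_outdom // mulr0 add0r in nz.
Qed.

Lemma supp_inD P f g : supp_in P f -> supp_in P g -> supp_in P (f + g).
Proof. by rewrite -[f in f + g]scale1r; apply: supp_inP. Qed.

Lemma supp_inZ P a f : supp_in P f -> supp_in P (a *: f).
Proof. by rewrite -[a *: f]addr0 => Pf; apply: supp_inP => //; apply: supp_in0. Qed.

Lemma supp_inU P k : P k -> supp_in P (mono k).
Proof. by move=> Pk k'; rewrite mono.unlock msuppU oner_eq0 inE => /eqP ->. Qed.

Lemma supp_in_ind P (Q : {malg rat[K]} -> Prop) : Q 0 ->
  (forall a k f, P k -> Q f -> Q (a *: mono k + f)) ->
  forall f, supp_in P f -> Q f.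
Proof.
move=> Q0 QS f Pf; rewrite (monalgE f).
have {}Pf : forall k, k \in enum_fset (msupp f) -> P k by [].
elim: (enum_fset (msupp f)) Pf => [|k s IH] Ps; first by rewrite big_nil.
rewrite big_cons.
have -> : << f@_k *g k >> = f@_k *: mono k :> {malg rat[K]}.
  by apply/malgP => k'; rewrite mono.unlock mcoeffZ !mcoeffU mulrnAr mulr1.
apply: QS; first by apply: Ps; rewrite inE eqxx.
by apply: IH => k' ks; apply: Ps; rewrite inE ks orbT.
Qed.

Definition restr P f : {malg rat[K]} :=
  mlin (fun k => if P k then mono k else 0) f.

Lemma restrU P k : restr P (mono k) = if P k then mono k else 0.
Proof. exact: mlinU. Qed.

Lemma restr_is_linear P : linear (restr P).
Proof. exact: mlin_is_linear. Qed.

Lemma mcoeff_restr P f k : (restr P f)@_k = if P k then f@_k else 0.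
Proof.
have: supp_in predT f by [].
move: f; apply: supp_in_ind => [|a k' f _ IH].
  by rewrite /restr linear0 mcoeff0 if_same.
rewrite restr_is_linear restrU mcoeffD mcoeffZ IH mcoeffD mcoeffZ.
have [<-|ne] := eqVneq k' k.
  by case: (P k'); rewrite // mcoeff0 mulr0 addr0.
have z : (mono k')@_k = 0 :> rat by rewrite mono.unlock mcoeffU (negbTE ne).
by case: (P k'); case: (P k); rewrite ?mcoeff0 ?z ?mulr0 ?add0r.
Qed.

Lemma supp_in_restr P f : supp_in P (restr P f).
Proof. by move=> k; rewrite -mcoeff_neq0 mcoeff_restr; case: (P k); rewrite ?eqxx. Qed.

Lemma restr_id P f : supp_in P f -> restr P f = f.
Proof.
move=> Pf; apply/malgP => k; rewrite mcoeff_restr.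
by case: ifPn => // nP; rewrite mcoeff_outdom //; apply: contra nP => /Pf.
Qed.

Lemma restr_disj P P' f : (forall k, P k -> ~~ P' k) -> supp_in P f ->
  restr P' f = 0.
Proof.
move=> dj Pf; apply/malgP => k; rewrite mcoeff_restr mcoeff0.
by case: ifPn => // P'k; rewrite mcoeff_outdom //; apply/negP => /Pf /dj/negP.
Qed.

Lemma restr_sum (p : K -> int) (s : seq int) f : uniq s ->
  (forall k, k \in msupp f -> p k \in s) ->
  f = \sum_(d <- s) restr (fun k => p k == d) f.
Proof.
move=> us ps; apply/malgP => k; rewrite (raddf_sum (mcoeff k)) /=.
under eq_bigr => d _ do rewrite mcoeff_restr.
have [kf|kf] := boolP (k \in msupp f); last first.
  by rewrite mcoeff_outdom // big1 // => d _; rewrite if_same.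
rewrite (bigD1_seq (p k)) ?ps //= eqxx big1 ?addr0 // => d ne.
by rewrite eq_sym (negbTE ne).
Qed.

End Support.

(* Bracket words in the letters [I]: the basis of the free magma algebra. *)
Inductive word (I : Type) := Gen of I | Br of word I & word I.

Fixpoint brackets I (t : word I) : nat :=
  if t is Br u v then (brackets u + brackets v).+1 else 0%N.

Fixpoint wdeg I (dg : I -> int) (t : word I) : int :=
  match t with Gen i => dg i | Br u v => wdeg dg u + wdeg dg v end.

Section WordChoice.
Variable I : Type.

Fixpoint word_tree (t : word I) : GenTree.tree I :=
  match t with
  | Gen i => GenTree.Leaf i
  | Br u v => GenTree.Node 0 [:: word_tree u; word_tree v]
  end.

Fixpoint tree_word (t : GenTree.tree I) : option (word I) :=
  match t with
  | GenTree.Leaf i => Some (Gen i)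
  | GenTree.Node _ [:: u; v] =>
      if tree_word u is Some u' then
        if tree_word v is Some v' then Some (Br u' v') else None
      else None
  | _ => None
  end.

Lemma word_treeK : pcancel word_tree tree_word.
Proof. by elim=> //= u -> v ->. Qed.
End WordChoice.

HB.instance Definition _ (I : choiceType) :=
  Choice.copy (word I) (pcan_type (@word_treeK I)).

HB.lock Definition mbr (I : choiceType) (f g : {malg rat[word I]}) :
  {malg rat[word I]} := mlin (fun t => mlin (fun u => mono (Br t u)) g) f.

Section FreeLie.
Variables (I : choiceType) (dg : I -> int).
Local Notation M := {malg rat[word I]}.
Implicit Types (f g : M) (t u v : word I).

Lemma mbrUU t u : mbr (mono t) (mono u) = mono (Br t u).
Proof. by rewrite mbr.unlock !mlinU. Qed.

Lemma mbrPl a f f' g : mbr (a *: f + f') g = a *: mbr f g + mbr f' g.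
Proof.
rewrite mbr.unlock; exact: mlin_is_linear. Qed.

Lemma mbrPr a f g g' : mbr f (a *: g + g') = a *: mbr f g + mbr f g'.
Proof.
rewrite mbr.unlock !(mlinEw _ (fsubset_refl (msupp f))) scaler_sumr -big_split; apply: eq_bigr => k _ /=.
by rewrite mlin_is_linear scalerDr !scalerA mulrC.
Qed.

Lemma mbr0l g : mbr 0 g = 0.
Proof. rewrite mbr.unlock; exact: linear0. Qed.

Lemma mbr0r f : mbr f 0 = 0.
Proof. by have := mbrPr 1 f 0 0; rewrite !scale1r addr0 -[LHS]addr0 => /addrI. Qed.

Lemma supp_in_mbr (P Q R : pred (word I)) f g :
  (forall t u, P t -> Q u -> R (Br t u)) ->
  supp_in P f -> supp_in Q g -> supp_in R (mbr f g).
Proof.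
move=> PQR Pf Qg; move: f Pf; apply: supp_in_ind => [|a t f Pt IH].
  by rewrite mbr0l; apply: supp_in0.
rewrite mbrPl; apply: supp_inP => //.
move: g Qg {IH}; apply: supp_in_ind => [|b u g Qu IH].
  by rewrite mbr0r; apply: supp_in0.
rewrite mbrPr mbrUU; apply: supp_inP => //.
by apply: supp_inU; apply: PQR.
Qed.

(* The two-sided ideal generated by graded antisymmetry and the graded Jacobi
   identity.  Both identities are multilinear in homogeneous arguments and
   homogeneous elements are combinations of words, so words suffice. *)
Inductive lie_ideal : M -> Prop :=
| lie_ideal0 : lie_ideal 0
| lie_idealP a f g : lie_ideal f -> lie_ideal g -> lie_ideal (a *: f + g)
| lie_ideal_brl f g : lie_ideal f -> lie_ideal (mbr f g)
| lie_ideal_brr f g : lie_ideal g -> lie_ideal (mbr f g)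
| lie_ideal_anti t u :
    lie_ideal (mono (Br u t) + (-1) ^ (wdeg dg t * wdeg dg u) *: mono (Br t u))
| lie_ideal_jacobi t u v :
    lie_ideal (mono (Br (Br t u) v) - mono (Br t (Br u v))
               + (-1) ^ (wdeg dg t * wdeg dg u) *: mono (Br u (Br t v))).

Definition lie_ideal_pred : {pred M} := fun f => `[< lie_ideal f >].

Lemma lie_ideal_submod : submod_closed lie_ideal_pred.
Proof.
split; first exact/asboolP/lie_ideal0.
by move=> a f g /asboolP If /asboolP Ig; apply/asboolP/lie_idealP.
Qed.

HB.instance Definition _ :=
  GRing.isSubmodClosed.Build rat M lie_ideal_pred lie_ideal_submod.

Definition freeLie : Type := Quotient.quot lie_ideal_pred.
HB.instance Definition _ := Choice.on freeLie.
HB.instance Definition _ := GRing.Zmodule.on freeLie.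

End FreeLie.

HB.lock Definition fl_pi (I : choiceType) (dg : I -> int)
  (f : {malg rat[word I]}) : freeLie dg :=
  \pi_(Quotient.quot (@lie_ideal_pred I dg)) f.

HB.lock Definition fl_repr (I : choiceType) (dg : I -> int)
  (x : freeLie dg) : {malg rat[word I]} :=
  repr (x : Quotient.quot (@lie_ideal_pred I dg)).

HB.lock Definition fl_scale (I : choiceType) (dg : I -> int) (a : rat)
  (x : freeLie dg) : freeLie dg := fl_pi dg (a *: fl_repr x).

HB.lock Definition fl_br (I : choiceType) (dg : I -> int)
  (x y : freeLie dg) : freeLie dg := fl_pi dg (mbr (fl_repr x) (fl_repr y)).

Section FreeLieTheory.
Variables (I : choiceType) (dg : I -> int).
Local Notation M := {malg rat[word I]}.
Local Notation freeLie := (freeLie dg).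
Local Notation fl_pi := (fl_pi dg).
Local Notation lie_ideal := (lie_ideal dg).
Implicit Types (f g : M) (t u v : word I).

Lemma fl_reprK x : fl_pi (fl_repr x) = x.
Proof. rewrite fl_pi.unlock fl_repr.unlock; exact: reprK. Qed.

Lemma fl_eqP f g : fl_pi f = fl_pi g <-> lie_ideal (f - g).
Proof.
rewrite fl_pi.unlock; split=> [/eqP|h]; first by rewrite -Quotient.idealrBE => /asboolP.
by apply/eqP; rewrite -Quotient.idealrBE; apply/asboolP.
Qed.

Lemma fl_piD f g : fl_pi (f + g) = fl_pi f + fl_pi g.
Proof. rewrite fl_pi.unlock; exact: (raddfD (\pi_(Quotient.quot (@lie_ideal_pred I dg)))). Qed.

Lemma lie_idealZ a f : lie_ideal f -> lie_ideal (a *: f).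
Proof. by move=> If; rewrite -[_ *: _]addr0; apply: lie_idealP => //; apply: lie_ideal0. Qed.

Lemma lie_idealD f g : lie_ideal f -> lie_ideal g -> lie_ideal (f + g).
Proof. by move=> If Ig; rewrite -[f]scale1r; apply: lie_idealP. Qed.

Lemma fl_repr_pi f : lie_ideal (fl_repr (fl_pi f) - f).
Proof. by apply/fl_eqP; rewrite fl_reprK. Qed.

Lemma fl_scale_pi a f : fl_scale a (fl_pi f) = fl_pi (a *: f).
Proof. by rewrite fl_scale.unlock; apply/fl_eqP; rewrite -scalerBr; apply/lie_idealZ/fl_repr_pi. Qed.

Lemma fl_scaleA a b (x : freeLie) : fl_scale a (fl_scale b x) = fl_scale (a * b) x.
Proof. by rewrite -(fl_reprK x) !fl_scale_pi scalerA. Qed.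

Lemma fl_scale1 : left_id 1 (@fl_scale I dg).
Proof. by move=> x; rewrite fl_scale.unlock scale1r fl_reprK. Qed.

Lemma fl_scaleDr : right_distributive (@fl_scale I dg) +%R.
Proof.
move=> a x y; rewrite -(fl_reprK x) -(fl_reprK y) -fl_piD !fl_scale_pi.
by rewrite scalerDr fl_piD.
Qed.

Lemma fl_scaleDl (x : freeLie) : {morph (@fl_scale I dg)^~ x : a b / a + b}.
Proof. by move=> a b; rewrite -(fl_reprK x) !fl_scale_pi scalerDl fl_piD. Qed.

HB.instance Definition _ := GRing.Zmodule_isLmodule.Build rat freeLie
  fl_scaleA fl_scale1 fl_scaleDr fl_scaleDl.

Lemma fl_pi_is_linear : linear fl_pi.
Proof. by move=> a f g; rewrite fl_piD -fl_scale_pi. Qed.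

HB.instance Definition _ :=
  GRing.isLinear.Build rat M freeLie _ fl_pi fl_pi_is_linear.

Lemma fl_piP a f g : fl_pi (a *: f + g) = a *: fl_pi f + fl_pi g.
Proof. exact: fl_pi_is_linear. Qed.

Lemma fl_pi0P f : fl_pi f = 0 <-> lie_ideal f.
Proof. by rewrite -(linear0 fl_pi) fl_eqP subr0. Qed.

Lemma mbrBl f f' g : mbr (f - f') g = mbr f g - mbr f' g.
Proof. by rewrite addrC -scaleN1r mbrPl scaleN1r addrC. Qed.

Lemma mbrBr f g g' : mbr f (g - g') = mbr f g - mbr f g'.
Proof. by rewrite addrC -scaleN1r mbrPr scaleN1r addrC. Qed.

Lemma fl_br_pi f g : fl_br (fl_pi f) (fl_pi g) = fl_pi (mbr f g).
Proof.
rewrite fl_br.unlock; apply/fl_eqP; rewrite -[X in X - _](subrK (mbr f (fl_repr (fl_pi g)))).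
rewrite -addrA -mbrBl -mbrBr; apply: lie_idealD.
  exact/lie_ideal_brl/fl_repr_pi.
exact/lie_ideal_brr/fl_repr_pi.
Qed.

(* The span in [freeLie] of the words satisfying [P]. *)
Definition spanned (P : pred (word I)) (x : freeLie) : Prop :=
  exists2 f, supp_in P f & x = fl_pi f.

Definition fl_deg (d : int) : freeLie -> Prop :=
  spanned (fun t => wdeg dg t == d).

Lemma spanned0 P : spanned P 0.
Proof. by exists 0; [apply: supp_in0 | rewrite linear0]. Qed.

Lemma spannedP P a x y : spanned P x -> spanned P y -> spanned P (a *: x + y).
Proof.
move=> [f Pf ->] [g Pg ->]; exists (a *: f + g); first exact: supp_inP.
by rewrite fl_piP.
Qed.

Lemma spanned_br (P Q R : pred (word I)) x y : (forall t u, P t -> Q u -> R (Br t u)) ->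
  spanned P x -> spanned Q y -> spanned R (fl_br x y).
Proof.
move=> PQR [f Pf ->] [g Qg ->]; rewrite fl_br_pi; exists (mbr f g) => //.
exact: supp_in_mbr PQR Pf Qg.
Qed.

Lemma fl_brPl a x y z : fl_br (a *: x + y) z = a *: fl_br x z + fl_br y z.
Proof.
have -> : a *: x + y = fl_pi (a *: fl_repr x + fl_repr y).
  by rewrite fl_piP !fl_reprK.
rewrite -[in RHS](fl_reprK x) -[in RHS](fl_reprK y) -(fl_reprK z) !fl_br_pi.
by rewrite mbrPl fl_piP.
Qed.

Lemma fl_brPr a x y z : fl_br z (a *: x + y) = a *: fl_br z x + fl_br z y.
Proof.
have -> : a *: x + y = fl_pi (a *: fl_repr x + fl_repr y).
  by rewrite fl_piP !fl_reprK.
rewrite -[in RHS](fl_reprK x) -[in RHS](fl_reprK y) -(fl_reprK z) !fl_br_pi.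
by rewrite mbrPr fl_piP.
Qed.

Lemma fl_br_deg i j x y : fl_deg i x -> fl_deg j y -> fl_deg (i + j) (fl_br x y).
Proof. by apply: spanned_br => t u /eqP <- /eqP <- /=. Qed.

Lemma fl_br_anti i j x y : fl_deg i x -> fl_deg j y ->
  fl_br y x = - ((-1) ^ (i * j) *: fl_br x y).
Proof.
move=> [f Pf ->] [g Qg ->]; rewrite !fl_br_pi; apply/eqP; rewrite -addr_eq0.
rewrite -linearZ -linearD /=; apply/eqP/fl_pi0P.
move: f Pf; apply: supp_in_ind => [|a t f /eqP Pt IH].
  by rewrite mbr0l mbr0r scaler0 addr0; apply: lie_ideal0.
rewrite mbrPl mbrPr scalerDr addrACA; apply: lie_idealD; last exact: IH.
rewrite scalerA mulrC -scalerA -scalerDr; apply: lie_idealZ => {IH f}.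
move: g Qg; apply: supp_in_ind => [|b u g /eqP Pu IH].
  by rewrite mbr0l mbr0r scaler0 addr0; apply: lie_ideal0.
rewrite mbrPl mbrPr scalerDr addrACA; apply: lie_idealD; last exact: IH.
rewrite scalerA mulrC -scalerA -scalerDr; apply: lie_idealZ => {IH g}.
by rewrite !mbrUU -Pt -Pu; apply: lie_ideal_anti.
Qed.

Lemma fl_br_jacobi i j k x y z : fl_deg i x -> fl_deg j y -> fl_deg k z ->
  fl_br (fl_br x y) z = fl_br x (fl_br y z) - (-1) ^ (i * j) *: fl_br y (fl_br x z).
Proof.
move=> [f Pf ->] [g Qg ->] [h Rh ->]; rewrite !fl_br_pi; apply/eqP.
rewrite -subr_eq0 opprB addrA addrAC -linearZ -!linearB -linearD /=.
apply/eqP/fl_pi0P; set c := (-1) ^ (i * j).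
pose J f g h := mbr (mbr f g) h - mbr f (mbr g h) + c *: mbr g (mbr f h).
have comb a (A1 A2 B1 B2 C1 C2 : M) :
    (a *: A1 + A2) - (a *: B1 + B2) + c *: (a *: C1 + C2) =
    a *: (A1 - B1 + c *: C1) + (A2 - B2 + c *: C2).
  rewrite !scalerDr scalerN !scalerA [c * a]mulrC opprD.
  by rewrite [X in X + _ = _]addrACA [LHS]addrACA.
have J1 a f1 f2 g1 h1 : J (a *: f1 + f2) g1 h1 = a *: J f1 g1 h1 + J f2 g1 h1.
  by rewrite /J !(mbrPl, mbrPr) comb.
have J2 a f1 g1 g2 h1 : J f1 (a *: g1 + g2) h1 = a *: J f1 g1 h1 + J f1 g2 h1.
  by rewrite /J !(mbrPl, mbrPr) comb.
have J3 a f1 g1 h1 h2 : J f1 g1 (a *: h1 + h2) = a *: J f1 g1 h1 + J f1 g1 h2.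
  by rewrite /J !(mbrPl, mbrPr) comb.
rewrite -[X in lie_ideal X]/(J f g h).
move: f Pf; apply: supp_in_ind => [|a t f /eqP Pt IH].
  rewrite /J !mbr0l mbr0r scaler0 subr0 addr0; exact: lie_ideal0.
rewrite J1; apply: lie_idealP; last exact: IH.
move: g Qg {f IH}; apply: supp_in_ind => [|b u g /eqP Pu IH].
  rewrite /J !mbr0l !mbr0r mbr0l scaler0 subr0 addr0; exact: lie_ideal0.
rewrite J2; apply: lie_idealP; last exact: IH.
move: h Rh {g IH}; apply: supp_in_ind => [|e v h /eqP Pv IH].
  rewrite /J !mbr0r scaler0 subr0 addr0; exact: lie_ideal0.
rewrite J3; apply: lie_idealP; last exact: IH.
rewrite /J (mbrUU t u) (mbrUU u v) (mbrUU t v).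
rewrite (mbrUU (Br t u) v) (mbrUU t (Br u v)) (mbrUU u (Br t v)) /c -Pt -Pu.
exact: (lie_ideal_jacobi dg t u v).
Qed.

Local Notation deg_is d := (fun t : word I => wdeg dg t == d).

Lemma restr_mbrU d f u :
  restr (deg_is d) (mbr f (mono u)) = mbr (restr (deg_is (d - wdeg dg u)) f) (mono u).
Proof.
have: supp_in predT f by []. 
move: f; apply: supp_in_ind => [|a t f _ IH].
  by rewrite /restr !linear0 mbr0l linear0.
rewrite mbrPl restr_is_linear IH restr_is_linear mbrPl mbrUU !restrU /=.
rewrite [wdeg dg t == _]eq_sym subr_eq eq_sym.
case: ifP => _; first by rewrite mbrUU.
by rewrite mbr0l.
Qed.

Lemma restr_Umbr d t g :
  restr (deg_is d) (mbr (mono t) g) = mbr (mono t) (restr (deg_is (d - wdeg dg t)) g).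
Proof.
have: supp_in predT g by [].
move: g; apply: supp_in_ind => [|a u g _ IH].
  by rewrite /restr !linear0 mbr0r linear0.
rewrite mbrPr restr_is_linear IH restr_is_linear mbrPr mbrUU !restrU /=.
rewrite [wdeg dg u == _]eq_sym subr_eq eq_sym [X in d == X]addrC.
case: ifP => _; first by rewrite mbrUU.
by rewrite mbr0r.
Qed.

Lemma restr_homog d d' f : supp_in (deg_is d') f ->
  restr (deg_is d) f = if d' == d then f else 0.
Proof.
move=> h; case: eqP => [<-|/eqP ne]; first exact: restr_id.
by apply: restr_disj h => t /eqP ->.
Qed.

Lemma lie_ideal_restr d f : lie_ideal f -> lie_ideal (restr (deg_is d) f).
Proof.
move=> If; elim: If d => {f} [|a f g _ IHf _ IHg|f g _ IH|f g _ IH|t u|t u v] d.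
- by rewrite /restr linear0; apply: lie_ideal0.
- by rewrite restr_is_linear; apply: lie_idealP.
- have: supp_in predT g by [].
  move: g; apply: supp_in_ind => [|a u g _ IHg].
    by rewrite mbr0r /restr linear0; apply: lie_ideal0.
  rewrite mbrPr restr_is_linear restr_mbrU; apply: lie_idealP; last exact: IHg.
  exact: lie_ideal_brl.
- have: supp_in predT f by [].
  move: f; apply: supp_in_ind => [|a t f _ IHf].
    by rewrite mbr0l /restr linear0; apply: lie_ideal0.
  rewrite mbrPl restr_is_linear restr_Umbr; apply: lie_idealP; last exact: IHf.
  exact: lie_ideal_brr.
- rewrite (@restr_homog _ (wdeg dg t + wdeg dg u)).
    by case: ifP => _; [apply: (lie_ideal_anti dg t u) | apply: lie_ideal0].
  apply: supp_inD; last apply: supp_inZ; apply: supp_inU; rewrite /wdeg -/wdeg.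
    by rewrite addrC eqxx.
  by rewrite eqxx.
- rewrite (@restr_homog _ (wdeg dg t + wdeg dg u + wdeg dg v)).
    by case: ifP => _; [apply: (lie_ideal_jacobi dg t u v) | apply: lie_ideal0].
  rewrite -scaleN1r; apply: supp_inD; last apply: supp_inZ; last first.
    by apply: supp_inU; rewrite /wdeg -/wdeg addrCA addrA eqxx.
  apply: supp_inD; last apply: supp_inZ; apply: supp_inU; rewrite /wdeg -/wdeg.
    by rewrite eqxx.
  by rewrite addrA eqxx.
Qed.

Lemma fl_deg_span x : exists (s : seq int) (c : int -> freeLie),
  (forall d, fl_deg d (c d)) /\ x = \sum_(d <- s) c d.
Proof.
pose f := fl_repr x; pose s := undup [seq wdeg dg t | t <- enum_fset (msupp f)].
exists s, (fun d => fl_pi (restr (deg_is d) f)); split.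
  by move=> d; exists (restr (deg_is d) f) => //; apply: supp_in_restr.
rewrite -(fl_reprK x) -/f -linear_sum -restr_sum ?undup_uniq // => k kf.
by rewrite mem_undup; apply: map_f.
Qed.

Lemma fl_deg_indep (s : seq int) (c : int -> freeLie) : uniq s ->
  (forall d, fl_deg d (c d)) -> \sum_(d <- s) c d = 0 ->
  forall d, d \in s -> c d = 0.
Proof.
move=> us cP; have /choice[f fP] : forall d, exists f, supp_in (deg_is d) f /\ c d = fl_pi f.
  by move=> d; have [f] := cP d; exists f.
under eq_bigr => d _ do rewrite (fP d).2.
rewrite -linear_sum => /fl_pi0P If d ds; rewrite (fP d).2; apply/fl_pi0P.
have := lie_ideal_restr d If.
rewrite /restr linear_sum (bigD1_seq d) //= -!/(restr _ _) big1 ?addr0 => [|d' ne].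
  by rewrite restr_id //; case: (fP d).
by rewrite -/(restr _ _) (restr_homog _ (fP d').1) (negbTE ne).
Qed.

HB.instance Definition _ := Lmodule_isGradedLie.Build freeLie
  (fun d => spanned0 _) (fun d => @spannedP _) fl_deg_span fl_deg_indep
  (fun z a x y => fl_brPl a x y z) (fun z a x y => fl_brPr a x y z)
  fl_br_deg fl_br_anti fl_br_jacobi.

End FreeLieTheory.

Section FreeLieUniversal.
Variables (I : choiceType) (dg : I -> int) (N : gradedLieType) (h : I -> N).
Hypothesis h_deg : forall i, hdeg (dg i) (h i).
Local Notation L := (freeLie dg).

Fixpoint word_eval (t : word I) : N :=
  match t with Gen i => h i | Br u v => lbr (word_eval u) (word_eval v) end.

Lemma word_eval_deg t : hdeg (wdeg dg t) (word_eval t).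
Proof. by elim: t => [i|u hu v hv]; [apply: h_deg | apply: hdeg_br]. Qed.

Lemma lbrPl (a : rat) (x y z : N) : lbr (a *: x + y) z = a *: lbr x z + lbr y z.
Proof. exact: lbr_linearl. Qed.

Lemma lbrPr (a : rat) (x y z : N) : lbr z (a *: x + y) = a *: lbr z x + lbr z y.
Proof. exact: lbr_linearr. Qed.

Lemma lbr0l (z : N) : lbr 0 z = 0.
Proof. by have := lbrPl (-1) 0 0 z; rewrite !scaleN1r oppr0 addr0 addNr. Qed.

Lemma lbr0r (z : N) : lbr z 0 = 0.
Proof. by have := lbrPr (-1) 0 0 z; rewrite !scaleN1r oppr0 addr0 addNr. Qed.

Lemma mlin_mbr f g :
  mlin word_eval (mbr f g) = lbr (mlin word_eval f) (mlin word_eval g).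
Proof.
have: supp_in predT f by [].
move: f; apply: supp_in_ind => [|a t f _ IH]; first by rewrite mbr0l !linear0 lbr0l.
rewrite mbrPl !mlin_is_linear IH lbrPl mlinU; congr (_ *: _ + _) => {IH f}.
have: supp_in predT g by [].
move: g; apply: supp_in_ind => [|a' u g _ IH]; first by rewrite mbr0r !linear0 lbr0r.
by rewrite mbrPr !mlin_is_linear IH lbrPr mbrUU !mlinU.
Qed.

Lemma mlin_lie_ideal f : lie_ideal dg f -> mlin word_eval f = 0.
Proof.
elim=> {f} [|a f g _ f0 _ g0|f g _ f0|f g _ g0|t u|t u v].
- exact: linear0.
- by rewrite mlin_is_linear f0 g0 scaler0 addr0.
- by rewrite mlin_mbr f0 lbr0l.
- by rewrite mlin_mbr g0 lbr0r.
- rewrite addrC mlin_is_linear !mlinU /=.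
  by rewrite (lbr_anti _ _ _ _ (word_eval_deg t) (word_eval_deg u)) addrN.
rewrite addrC mlin_is_linear -[mono _ - _]addrC -scaleN1r mlin_is_linear !mlinU /=.
rewrite (lbr_jacobi _ _ _ _ _ _ (word_eval_deg t) (word_eval_deg u) (word_eval_deg v)).
by rewrite scaleN1r addKr addrN.
Qed.

(* [freeLie dg] is the free graded Lie algebra on letters [i] of degree [dg i]. *)
Lemma freeLie_universal :
  exists F : L -> N, [/\ glie_morphism F,
    forall i, F (fl_pi dg (mono (Gen i))) = h i
  & forall G : L -> N, glie_morphism G ->
      (forall i, G (fl_pi dg (mono (Gen i))) = h i) -> G =1 F].
Proof.
pose F (x : L) := mlin word_eval (fl_repr x).
have Fpi f : F (fl_pi dg f) = mlin word_eval f.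
  apply/eqP; rewrite -subr_eq0 -linearB; apply/eqP.
  exact/mlin_lie_ideal/fl_repr_pi.
have Flin : linear F.
  by move=> a x y; rewrite -(fl_reprK x) -(fl_reprK y) -fl_piP !Fpi mlin_is_linear.
exists F; split=> [||G [Glin _ Gbr] Ggen x].
- split=> // [d x [f fd ->]|x y].
    rewrite Fpi; move: f fd; apply: supp_in_ind => [|a t f /eqP <- IH].
      by rewrite linear0; apply: hdeg0.
    by rewrite mlin_is_linear mlinU; apply: hdegP => //; apply: word_eval_deg.
  by rewrite -(fl_reprK x) -(fl_reprK y) [lbr _ _]fl_br_pi !Fpi mlin_mbr.
- by move=> i; rewrite Fpi mlinU.
have Gt t : G (fl_pi dg (mono t)) = word_eval t.
  by elim: t => [i|u hu v hv] /=; rewrite ?Ggen // -hu -hv -Gbr -mbrUU [lbr _ _]fl_br_pi.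
rewrite -(fl_reprK x) Fpi.
have GL : linear (fun f => G (fl_pi dg f)) by move=> a f g; rewrite fl_piP Glin.
rewrite (mlin_eq GL) mlin.unlock; apply: eq_bigr => t _; by rewrite Gt.
Qed.

End FreeLieUniversal.

Section Convolution.
Variable V : zmodType.

Lemma conv_sum N n (F : nat -> nat -> V) : (n <= N)%N ->
  \sum_(i < n) F i (n.-1 - i)%N =
  \sum_(i < N) \sum_(j < N | (i + j).+1 == n) F i j.
Proof.
move=> le; rewrite (big_ord_widen N (fun i => F i (n.-1 - i)%N) le) big_mkcond.
apply: eq_bigr => i _ /=; case: ltnP => lt.
  have jN : (n.-1 - i < N)%N by case: n lt le => //= n lt le; apply: leq_ltn_trans (leq_subr _ _) _.
  rewrite (big_pred1 (Ordinal jN)) // => j; rewrite -[RHS]val_eqE /=.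
  case: n lt {le jN} => // n; rewrite ltnS eqSS /= => le.
  by rewrite -(eqn_add2l i j) subnKC.
rewrite big_pred0 // => j; apply/negbTE; rewrite neq_ltn orbC.
by rewrite ltnS (leq_trans lt) // leq_addr.
Qed.

Lemma conv3 n (G : nat -> nat -> nat -> V) :
  \sum_(i < n) \sum_(m < n | (i + m).+1 == n)
     \sum_(j < n) \sum_(k < n | (j + k).+1 == m) G i j k =
  \sum_(i < n) \sum_(j < n) \sum_(k < n | (i + j + k).+2 == n) G i j k.
Proof.
apply: eq_bigr => i _; rewrite exchange_big; apply: eq_bigr => j _ /=.
rewrite (exchange_big_dep (fun k : 'I_n => (i + j + k).+2 == n)) /=; last first.
  by move=> m k /eqP e1 /eqP e2; rewrite -addnA -addnS e2 e1.
apply: eq_bigr => k /eqP e.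
have mn : ((j + k).+1 < n)%N 
  by apply: leq_trans (eq_leq e); rewrite !ltnS -addnA leq_addl.
rewrite (big_pred1 (Ordinal mn)) // => m; rewrite -[RHS]val_eqE /=.
have [->|ne] := eqVneq (m : nat) (j + k).+1.
  by rewrite ?eqxx ?andbT addnS addnA e ?eqxx.
by rewrite ?andbF.
Qed.

End Convolution.

Section CompletedFreeLie.
Variables (I : choiceType) (dg : I -> int).
Local Notation L := (freeLie dg).

(* An element of the completion is a sequence [x] with [x n] in L^(n), the span
   of the words with exactly [n] brackets.  Its degrees must lie in a finite
   set [s], since the completion is the direct sum over the degrees [d] of the
   products over [n] of the L^(n)_d. *)
Definition cfree_pred : {pred nat -> L} := fun x => `[< exists s : seq int,
  forall n, spanned (fun t => (brackets t == n) && (wdeg dg t \in s)) (x n) >].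

Lemma spannedS (P Q : pred (word I)) (x : L) : (forall t, P t -> Q t) ->
  spanned P x -> spanned Q x.
Proof. by move=> PQ [f Pf ->]; exists f => // t /Pf /PQ. Qed.

Lemma cfree_submod : submod_closed cfree_pred.
Proof.
split; first by apply/asboolP; exists [::] => n; apply: spanned0.
move=> a x y /asboolP [s sx] /asboolP [s' sy]; apply/asboolP.
exists (s ++ s') => n; apply: spannedP.
  by apply: spannedS (sx n) => t /andP [-> ts]; rewrite mem_cat ts.
by apply: spannedS (sy n) => t /andP [-> ts]; rewrite mem_cat ts orbT.
Qed.

HB.instance Definition _ :=
  GRing.isSubmodClosed.Build rat (nat -> L) cfree_pred cfree_submod.

Record cfree := CFree { brcomp : nat -> L; brcompP : brcomp \in cfree_pred }.

HB.instance Definition _ := [isSub for brcomp].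
HB.instance Definition _ := [Choice of cfree by <:].
HB.instance Definition _ := [SubChoice_isSubLmodule of cfree by <:].

Lemma cfree_ext (x y : cfree) : (forall n, brcomp x n = brcomp y n) -> x = y.
Proof. by move=> e; apply/val_inj/funext. Qed.

Lemma brcompPl a (x y : cfree) n : brcomp (a *: x + y) n = a *: brcomp x n + brcomp y n.
Proof. by rewrite -[brcomp]/(val : cfree -> _) linearP. Qed.

Lemma brcomp0 n : brcomp 0 n = 0.
Proof. by rewrite -[brcomp]/(val : cfree -> _) linear0. Qed.

Lemma brcomp_sum (J : Type) (r : seq J) (P : pred J) (F : J -> cfree) n :
  brcomp (\sum_(j <- r | P j) F j) n = \sum_(j <- r | P j) brcomp (F j) n.
Proof. by rewrite -[brcomp]/(val : cfree -> _) raddf_sum fct_sumE. Qed.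

(* A bracket of elements of L^(i) and L^(j) lies in L^(i + j + 1). *)
Definition conv (x y : nat -> L) (n : nat) : L :=
  \sum_(i < n) lbr (x i) (y (n.-1 - i)%N).

Lemma spanned_sum (P : pred (word I)) (J : Type) (r : seq J) (Q : pred J) (F : J -> L) :
  (forall j, Q j -> spanned P (F j)) -> spanned P (\sum_(j <- r | Q j) F j).
Proof.
move=> h; elim/big_ind: _ => //; first exact: spanned0.
by move=> x y Px Py; rewrite -[x]scale1r; apply: spannedP.
Qed.

Lemma spanned_conv (R1 R2 R : int -> bool) (x y : nat -> L) n :
  (forall d e, R1 d -> R2 e -> R (d + e)) ->
  (forall n, spanned (fun t => (brackets t == n) && R1 (wdeg dg t)) (x n)) ->
  (forall n, spanned (fun t => (brackets t == n) && R2 (wdeg dg t)) (y n)) ->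
  spanned (fun t => (brackets t == n) && R (wdeg dg t)) (conv x y n).
Proof.
move=> RR xP yP; apply: spanned_sum => i _.
apply: spanned_br (xP i) (yP _) => t u /andP [/eqP bt Rt] /andP [/eqP bu Ru] /=.
rewrite bt bu RR // andbT; case: n i {bt bu} => [[]//|n] i /=.
by rewrite subnKC // -ltnS.
Qed.

Lemma cfree_conv (x y : cfree) : conv (brcomp x) (brcomp y) \in cfree_pred.
Proof.
have /asboolP [s sx] := brcompP x; have /asboolP [s' sy] := brcompP y.
apply/asboolP; exists [seq d + e | d <- s, e <- s'] => n.
apply: (@spanned_conv (mem s) (mem s') (mem [seq d + e | d <- s, e <- s'])).
- by move=> d e ds es; apply: allpairs_f.
- exact: sx.
- exact: sy.
Qed.

Definition cfree_br (x y : cfree) : cfree := CFree (cfree_conv x y).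

Definition cfree_deg (d : int) (x : cfree) : Prop :=
  forall n, spanned (fun t => (brackets t == n) && (wdeg dg t == d)) (brcomp x n).

Lemma cfree_deg0 d : cfree_deg d 0.
Proof. by move=> n; rewrite brcomp0; apply: spanned0. Qed.

Lemma cfree_degP d a x y : cfree_deg d x -> cfree_deg d y -> cfree_deg d (a *: x + y).
Proof. by move=> dx dy n; rewrite brcompPl; apply: spannedP. Qed.

Lemma cfree_deg_comp d x n : cfree_deg d x -> hdeg d (brcomp x n).
Proof. by move=> /(_ n); apply: spannedS => t /andP []. Qed.

Lemma cfree_deg_span x : exists (s : seq int) (c : int -> cfree),
  (forall d, cfree_deg d (c d)) /\ x = \sum_(d <- s) c d.
Proof.
have /asboolP [s0 s0x] := brcompP x.
have {s0 s0x} [s us sx] : exists2 s : seq int, uniq s & forall n,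
    spanned (fun t => (brackets t == n) && (wdeg dg t \in s)) (brcomp x n).
  exists (undup s0); first exact: undup_uniq.
  by move=> n; apply: spannedS (s0x n) => t; rewrite mem_undup.
have /choice [f fP] : forall n, exists f, supp_in (fun t => (brackets t == n) &&
    (wdeg dg t \in s)) f /\ brcomp x n = fl_pi dg f.
  by move=> n; have [f] := sx n; exists f.
pose c d n : L := fl_pi dg (restr (fun t => wdeg dg t == d) (f n)).
have cP d n : spanned (fun t => (brackets t == n) && (wdeg dg t == d)) (c d n).
  exists (restr (fun t => wdeg dg t == d) (f n)) => // t.
  rewrite -mcoeff_neq0 mcoeff_restr; case: ifP => [e|]; last by rewrite eqxx.
  by rewrite mcoeff_neq0 => /(fP n).1 /andP [bt _] /=; rewrite bt.
have cm d : c d \in cfree_pred.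
  apply/asboolP; exists [:: d] => n; apply: spannedS (cP d n) => t.
  by rewrite inE.
exists s, (fun d => CFree (cm d)); split=> [d n|]; first exact: cP.
apply: cfree_ext => n; rewrite brcomp_sum /= (fP n).2 /c -linear_sum -restr_sum //.
by move=> t /(fP n).1 /andP [].
Qed.

Lemma cfree_deg_indep (s : seq int) (c : int -> cfree) : uniq s ->
  (forall d, cfree_deg d (c d)) -> \sum_(d <- s) c d = 0 ->
  forall d, d \in s -> c d = 0.
Proof.
move=> us cP c0 d ds; apply: cfree_ext => n; rewrite brcomp0.
apply: (@hdeg_indep L s (fun d => brcomp (c d) n)) => // [d'|].
  exact: cfree_deg_comp.
by rewrite -brcomp_sum c0 brcomp0.
Qed.

Lemma cfree_brPl a x y z :
  cfree_br (a *: x + y) z = a *: cfree_br x z + cfree_br y z.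
Proof.
apply: cfree_ext => n; rewrite brcompPl /= /conv scaler_sumr -big_split.
apply: eq_bigr => i _.
exact: (lbr_linearl (brcomp z (n.-1 - i)) a (brcomp x i) (brcomp y i)).
Qed.

Lemma cfree_brPr z a x y :
  cfree_br z (a *: x + y) = a *: cfree_br z x + cfree_br z y.
Proof.
apply: cfree_ext => n; rewrite brcompPl /= /conv scaler_sumr -big_split.
apply: eq_bigr => i _.
exact: (lbr_linearr (brcomp z i) a (brcomp x (n.-1 - i)) (brcomp y (n.-1 - i))).
Qed.

Lemma cfree_br_deg i j x y :
  cfree_deg i x -> cfree_deg j y -> cfree_deg (i + j) (cfree_br x y).
Proof.
move=> xi yj n.
apply: (@spanned_conv (fun d => d == i) (fun d => d == j) (fun d => d == i + j)) => //.
by move=> d e /eqP -> /eqP ->.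
Qed.

Lemma cfree_br_anti i j x y : cfree_deg i x -> cfree_deg j y ->
  cfree_br y x = - ((-1) ^ (i * j) *: cfree_br x y).
Proof.
move=> xi yj; rewrite -scaleNr -[RHS]addr0; apply: cfree_ext => n.
rewrite brcompPl brcomp0 addr0 /= /conv (reindex_inj rev_ord_inj) scaler_sumr.
apply: eq_bigr => k _ /=; rewrite scaleNr.
have -> : (n.-1 - (n - k.+1) = k)%N.
  by case: n k => [[]//|n] k; rewrite subSS /= subKn // -ltnS.
have -> : (n - k.+1 = n.-1 - k)%N by case: n k => [[]//|n] k; rewrite subSS.
by apply: lbr_anti; apply: cfree_deg_comp.
Qed.

Lemma lbr_suml (x : L) (J : Type) (r : seq J) (P : pred J) (F : J -> L) :
  lbr (\sum_(j <- r | P j) F j) x = \sum_(j <- r | P j) lbr (F j) x.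
Proof.
apply: (big_morph (fun y => lbr y x)) => [y z|].
  by have := lbr_linearl x 1 y z; rewrite !scale1r.
by have := lbr_linearl x (-1) 0 0; rewrite !scaleN1r oppr0 addr0 addNr.
Qed.

Lemma lbr_sumr (x : L) (J : Type) (r : seq J) (P : pred J) (F : J -> L) :
  lbr x (\sum_(j <- r | P j) F j) = \sum_(j <- r | P j) lbr x (F j).
Proof.
apply: (big_morph (fun y => lbr x y)) => [y z|].
  by have := lbr_linearr x 1 y z; rewrite !scale1r.
by have := lbr_linearr x (-1) 0 0; rewrite !scaleN1r oppr0 addr0 addNr.
Qed.

Lemma conv_r (x y z : nat -> L) n : conv x (conv y z) n =
  \sum_(i < n) \sum_(j < n) \sum_(k < n | (i + j + k).+2 == n)
     lbr (x i) (lbr (y j) (z k)).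
Proof.
rewrite -(conv3 n (fun i j k => lbr (x i) (lbr (y j) (z k)))).
rewrite /conv (conv_sum (fun i m => lbr (x i) (conv y z m)) (leqnn n)).
apply: eq_bigr => i _; apply: eq_bigr => m _.
rewrite /conv (conv_sum (fun j k => lbr (y j) (z k)) (ltnW (ltn_ord m))) lbr_sumr.
by apply: eq_bigr => j _; rewrite lbr_sumr.
Qed.

Lemma conv_l (x y z : nat -> L) n : conv (conv x y) z n =
  \sum_(i < n) \sum_(j < n) \sum_(k < n | (i + j + k).+2 == n)
     lbr (lbr (x i) (y j)) (z k).
Proof.
transitivity (\sum_(k < n) \sum_(i < n) \sum_(j < n | (k + i + j).+2 == n)
     lbr (lbr (x i) (y j)) (z k)); last first.
  rewrite exchange_big; apply: eq_bigr => i _; rewrite (exchange_big_dep predT) //=.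
  apply: eq_bigr => j _; apply: eq_bigl => k.
  by rewrite -addnA addnC.
rewrite -(conv3 n (fun k i j => lbr (lbr (x i) (y j)) (z k))).
rewrite /conv (conv_sum (fun m k => lbr (conv x y m) (z k)) (leqnn n)).
rewrite (exchange_big_dep predT) //=; apply: eq_bigr => k _.
apply: eq_big => [m|m _]; first by rewrite addnC.
rewrite /conv (conv_sum (fun i j => lbr (x i) (y j)) (ltnW (ltn_ord m))) lbr_suml.
by apply: eq_bigr => j _; rewrite lbr_suml.
Qed.

Lemma cfree_br_jacobi i j k x y z :
  cfree_deg i x -> cfree_deg j y -> cfree_deg k z ->
  cfree_br (cfree_br x y) z =
  cfree_br x (cfree_br y z) - (-1) ^ (i * j) *: cfree_br y (cfree_br x z).
Proof.
move=> xi yj zk; rewrite -scaleNr addrC; apply: cfree_ext => n.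
rewrite brcompPl /= conv_l !conv_r addrC.
rewrite [X in _ *: X]exchange_big scaler_sumr -big_split; apply: eq_bigr => p _ /=.
rewrite scaler_sumr -big_split; apply: eq_bigr => q _ /=.
rewrite [(q + p)%N]addnC scaler_sumr -big_split; apply: eq_bigr => r _ /=.
by rewrite scaleNr; apply: lbr_jacobi; apply: cfree_deg_comp.
Qed.

HB.instance Definition _ := Lmodule_isGradedLie.Build cfree
  cfree_deg0 cfree_degP cfree_deg_span cfree_deg_indep
  (fun z a x y => cfree_brPl a x y z) cfree_brPr
  cfree_br_deg cfree_br_anti cfree_br_jacobi.

Definition cgen_comp (i : I) (n : nat) : L :=
  if n is 0%N then fl_pi dg (mono (Gen i)) else 0.

Lemma cgen_subproof i : cgen_comp i \in cfree_pred.
Proof.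
apply/asboolP; exists [:: dg i] => -[|n] /=; last exact: spanned0.
by exists (mono (Gen i)) => //; apply: supp_inU; rewrite /= inE eqxx.
Qed.

Definition cgen (i : I) : cfree := CFree (cgen_subproof i).

(* Convergence of a series with respect to the number of brackets. *)
Definition sums_to (u : nat -> cfree) (s : cfree) : Prop :=
  forall n, exists N, forall m, (N <= m)%N ->
    brcomp (\sum_(k < m) u k) n = brcomp s n.

End CompletedFreeLie.

(* Formal power series in non-commuting variables [T]: [s w] is the coefficient
   of the word [w]. *)
Notation ncseries T := (seq T -> rat^o).

Section NCSeries.
Variable T : eqType.
Implicit Types (s r : ncseries T) (w : seq T).

Definition sone : ncseries T := fun w => (w == [::])%:R.
Definition sletter (i : T) : ncseries T := fun w => (w == [:: i])%:R.
Definition smul s r : ncseries T :=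
  fun w => \sum_(k < (size w).+1) s (take k w) * r (drop k w).
Definition spow s n : ncseries T := iter n (smul s) sone.

(* Meaningful only for [s] with zero constant term: then [s ^ k] vanishes on
   words of length less than [k], so the truncated sum is the full one. *)
Definition sexp s : ncseries T :=
  fun w => \sum_(k < (size w).+1) (k`!%:R)^-1 * spow s k w.

End NCSeries.

(* [(bernoulli_seq m)`_n] is the coefficient of x^n in x / (exp x - 1), computed
   by power series division; see [bernoulli_egf]. *)
Fixpoint bernoulli_seq (n : nat) : seq rat :=
  if n is m.+1 then
    let s := bernoulli_seq m in
    rcons s ((m == 0%N)%:R - \sum_(k < m) s`_k / (m.+1 - k)`!%:R)
  else [::].

Definition bernoulli (n : nat) : rat := n`!%:R * (bernoulli_seq n.+1)`_n.

Lemma bernoulli_seqE m n : (n < m)%N ->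
  (bernoulli_seq m)`_n = bernoulli n / n`!%:R.
Proof.
have sz k : size (bernoulli_seq k) = k by elim: k => //= k IH; rewrite size_rcons IH.
have nz : n`!%:R != 0 :> rat by rewrite Num.Theory.pnatr_eq0 -lt0n fact_gt0.
move=> lt; rewrite /bernoulli [RHS]mulrC mulKf //.
elim: m lt => // m IH; rewrite ltnS leq_eqVlt => /orP [/eqP -> //|lt].
by rewrite [bernoulli_seq m.+1]/= nth_rcons sz lt IH.
Qed.

Lemma bernoulli_rec n :
  \sum_(k < n.+1) bernoulli k / k`!%:R / (n.+1 - k)`!%:R = (n == 0%N)%:R.
Proof.
have sz k : size (bernoulli_seq k) = k by elim: k => //= k IH; rewrite size_rcons IH.
rewrite big_ord_recr /= subSnn divr1 -(bernoulli_seqE (ltnSn n)) /=.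
rewrite nth_rcons sz ltnn eqxx addrC -addrA -[RHS]addr0; congr (_ + _).
apply/eqP; rewrite addrC subr_eq0; apply/eqP; apply: eq_bigr => k _.
by rewrite bernoulli_seqE.
Qed.

Lemma spow_sletter n (w : seq unit) : spow (sletter tt) n w = (size w == n)%:R.
Proof.
elim: n w => [|n IH] w; first by rewrite /= /sone size_eq0.
rewrite /spow iterS -/(spow _ _) /smul.
case: w => [|[] w]; first by rewrite big_ord1 /= /sletter mul0r.
rewrite big_ord_recl big_ord_recl /= /sletter mul0r add0r take0 drop0 mul1r.
rewrite big1 ?addr0 => [|k _].
  by rewrite IH.
case: w k => [[]//|[] w] k /=.
by rewrite mul0r.
Qed.

Lemma sexp_sletter (w : seq unit) : sexp (sletter tt) w = ((size w)`!%:R)^-1.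
Proof.
rewrite /sexp big_ord_recr /= spow_sletter eqxx mulr1 big1 ?add0r // => k _.
by rewrite spow_sletter gtn_eqF ?mulr0.
Qed.

(* (\sum_n B_n x^n / n!) (exp x - 1) = x, as power series in one variable. *)
Lemma bernoulli_egf :
  smul (fun w : seq unit => bernoulli (size w) / (size w)`!%:R)
       (sexp (sletter tt) - @sone unit) = sletter tt.
Proof.
apply: funext => w; rewrite /smul big_ord_recr /= drop_size.
rewrite [X in _ + X](_ : _ = 0) ?addr0; last first.
  by rewrite addrfctE opprfctE sexp_sletter /= /sone eqxx invr1 subrr mulr0.
transitivity (\sum_(k < size w) bernoulli k / k`!%:R / (size w - k)`!%:R).
  apply: eq_bigr => k _; rewrite addrfctE opprfctE sexp_sletter size_takel 1?ltnW //.
  by rewrite size_drop /sone -size_eq0 size_drop subn_eq0 leqNgt ltn_ord subr0.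
case: w => [|[] w]; first by rewrite big_ord0.
by rewrite bernoulli_rec /sletter; case: w.
Qed.

(* [b] is the Lie series in two variables x ([false]) and y ([true]) with
   exp b = exp x exp y.  [iota] is the Lie map to the associative series with
   iota x = x and iota y = y; it is unique, since every element with at least
   n + 1 brackets is a sum of two brackets [x, u] + [y, v] where u and v have
   at least n brackets. *)
Definition bch_series (b : cfree (fun _ : bool => 0%:Z)) : Prop :=
  exists iota : cfree (fun _ : bool => 0%:Z) -> ncseries bool,
    [/\ linear iota,
        forall u v, iota (lbr u v) = smul (iota u) (iota v) - smul (iota v) (iota u),
        iota (cgen _ false) = sletter false,
        iota (cgen _ true) = sletter true
      & sexp (iota b) = smul (sexp (sletter false)) (sexp (sletter true))].

(* [z] is the value of the Baker-Campbell-Hausdorff series at [x] and [y], that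
   is, its image under the (unique) morphism sending the variables to them. *)
Definition is_BCH (I : choiceType) (dg : I -> int) (x y z : cfree dg) : Prop :=
  exists2 b, bch_series b &
  exists phi : cfree (fun _ : bool => 0%:Z) -> cfree dg,
    [/\ glie_morphism phi, phi (cgen _ false) = x, phi (cgen _ true) = y
      & phi b = z].

(* d e = [e, b] + \sum_i (B_i / i!) (ad e)^i (b - a) *)
Definition interval_differential (I : choiceType) (dg : I -> int)
    (d : cfree dg -> cfree dg) (e a b : cfree dg) : Prop :=
  sums_to (fun i => (bernoulli i / i`!%:R) *: iter i (lbr e) (b - a))
          (d e - lbr e b).

Inductive genA := A_a0 | A_a2 | A_e.
Inductive genB := B_a0 | B_a1 | B_a2 | B_e1 | B_e2.

Definition genA_nat g := match g with A_a0 => 0%N | A_a2 => 2%N | A_e => 3%N end.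
Definition nat_genA n :=
  match n with 0%N => Some A_a0 | 2%N => Some A_a2 | 3%N => Some A_e | _ => None end.
Lemma genA_natK : pcancel genA_nat nat_genA. Proof. by case. Qed.
HB.instance Definition _ := Countable.copy genA (pcan_type genA_natK).

Definition genB_nat g := match g with
  B_a0 => 0%N | B_a1 => 1%N | B_a2 => 2%N | B_e1 => 3%N | B_e2 => 4%N end.
Definition nat_genB n := match n with
  0%N => Some B_a0 | 1%N => Some B_a1 | 2%N => Some B_a2 | 3%N => Some B_e1
| 4%N => Some B_e2 | _ => None end.
Lemma genB_natK : pcancel genB_nat nat_genB. Proof. by case. Qed.
HB.instance Definition _ := Countable.copy genB (pcan_type genB_natK).

Definition degA g : int := match g with A_a0 | A_a2 => -1 | A_e => 0 end.
Definition degB g : int :=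
  match g with B_a0 | B_a1 | B_a2 => -1 | B_e1 | B_e2 => 0 end.

(* Main.v *)
From HB Require Import structures.
Require Import Defs.
From mathcomp Require Import all_boot all_order all_algebra.
From mathcomp Require Import boolp functions.
Set Implicit Arguments.
Unset Strict Implicit.
Unset Printing Implicit Defensive.
Import GRing.Theory.
Local Open Scope ring_scope.

(** The formula for the differential of [e] says that the flow of [e] carries one
endpoint to the other.  Write [X] for the bracket with [e] and multiply
[d e - X b = X / (exp X - 1) (b - a)] by [(exp X - 1) / X]: the formula becomes
[exp X b - (exp X - 1) / X (d e) = a].  Adjoin the differential [d] to the Lie
algebra as an element with [[d, x] = d x], hence [[e, d] = - d e]; the last
equation is then [exp (ad e) (d + b) = d + a].  This equivalence is [gaugeP]
and, in a completed free Lie algebra, [interval_gauge].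

In this form intervals compose.  From [exp (ad e1) (d + b1) = d + b0] and
[exp (ad e2) (d + b2) = d + b1] one gets
[exp (ad e1) (exp (ad e2) (d + b2)) = d + b0], and since [ad] is a
representation of the elements of degree 0 ([gauge_act_lbr]), the product of
the two exponentials is the exponential of the action of the
Baker-Campbell-Hausdorff element [z].  Hence [z] satisfies the interval formula
from [b0] to [b2] ([interval_differential_BCH]).  To compare exponentials of
operators with exponentials of noncommutative power series, operators are
substituted for the letters of a series; substitution is multiplicative
([eval_mul]) and takes the associative image of a Lie series to the action of
that Lie series ([eval_iota]).

The map [p] is the morphism given by the universal property of the completed
free Lie algebra ([cfree_universal]).  The defect [p dA - dB p] vanishes on the
generators, on [e] because [p] is continuous and both sides are sums of the same
series.  It then vanishes everywhere, because an element is a combination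
of generators plus brackets of a generator with another element, so that
the defect has arbitrarily large order ([cfree_induction]).

It remains to know that [log (exp x exp y)] is a Lie series ([bch_exists]).  Let
[E] multiply each word by its length.  The equation
[E f = x f + f y] with constant term 1 has [exp x exp y] as its only solution.
For [f = exp W] the equation follows from
[E W - [W, y] = sum_i B_i / i! (ad W)^i (y + x)] ([seuler_sexp]).  That is again the
interval formula, now with [E] as differential and endpoints [- x] and [y], and
[gaugeP] applies to it.  Its right-hand side involves Lie operations only and in each number of brackets it
uses only the parts of [W] with fewer brackets, so it can be solved by recursion
among Lie series ([bch_fixpoint]); unrolling the recursion gives the terms of
low order ([bch_low_order]). *)

(** * Noncommutative power series *)

Section NCAlgebra.
Variable T : eqType.
Implicit Types (s r t : ncseries T) (w : seq T).

(** The left derivative: [s] is its constant term plus the sum over the letters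
[i] of [i] times [sshift i s].  Associativity of the product and the substitution
of operators for letters are proved along this decomposition. *)
Definition sshift (i : T) s : ncseries T := fun w => s (i :: w).

(** The Euler derivation of the algebra of series. *)
Definition seuler s : ncseries T := fun w => (size w)%:R * s w.

Lemma smul_nil s r : smul s r [::] = s [::] * r [::].
Proof. by rewrite /smul big_ord1. Qed.

Lemma smul_cons s r i w :
  smul s r (i :: w) = s [::] * r (i :: w) + smul (sshift i s) r w.
Proof. by rewrite /smul big_ord_recl. Qed.

Lemma ncPE a s r w : (a *: s + r) w = a * s w + r w.
Proof. by []. Qed.

Lemma ncZE a s w : (a *: s) w = a * s w.
Proof. by []. Qed.

Lemma smulPl a s s' r : smul (a *: s + s') r = a *: smul s r + smul s' r.
Proof.
apply/funext => w; rewrite ncPE /smul mulr_sumr -big_split.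
by apply: eq_bigr => k _; rewrite ncPE mulrDl -mulrA.
Qed.

Lemma smulPr s a r r' : smul s (a *: r + r') = a *: smul s r + smul s r'.
Proof.
apply/funext => w; rewrite ncPE /smul mulr_sumr -big_split.
by apply: eq_bigr => k _; rewrite ncPE mulrDr mulrCA.
Qed.

Lemma sshift_smul i s r :
  sshift i (smul s r) = s [::] *: sshift i r + smul (sshift i s) r.
Proof. by apply/funext => w; rewrite /sshift smul_cons. Qed.

Lemma smulA s r t : smul s (smul r t) = smul (smul s r) t.
Proof.
apply/funext => w; elim: w s r => [|i w IH] s r; first by rewrite !smul_nil mulrA.
by rewrite !smul_cons smul_nil sshift_smul smulPl ncPE -!IH mulrDr mulrA -addrA.
Qed.

Lemma smul1s s : smul (@sone T) s = s.
Proof.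
apply/funext => w; rewrite /smul big_ord_recl take0 drop0 mul1r big1 ?addr0 // => k _.
by rewrite /sone; case: w k => [[]//|i w] k; rewrite /= mul0r.
Qed.

Lemma smuls1 s : smul s (@sone T) = s.
Proof.
apply/funext => w; rewrite /smul big_ord_recr /= take_size drop_size mulr1.
rewrite big1 ?add0r // => k _; rewrite /sone -size_eq0 size_drop subn_eq0.
by rewrite leqNgt ltn_ord mulr0.
Qed.

Lemma seuler_smul s r : seuler (smul s r) = smul (seuler s) r + smul s (seuler r).
Proof.
apply/funext => w; rewrite addrfctE /seuler /smul mulr_sumr -big_split.
apply: eq_bigr => k _ /=; rewrite size_drop size_takel -1?ltnS //.
rewrite -mulrA [X in _ = _ + X]mulrCA -mulrDl -natrD subnKC // -ltnS.
exact: ltn_ord.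
Qed.

End NCAlgebra.

(** * Complete filtered spaces *)

(** Maps with a proof of linearity in place of a bundled linear map, since the
morphisms and differentials of interest come as functions with properties. *)
Section Linear.
Variables (U V : lmodType rat) (f : U -> V).
Hypothesis lf : linear f.

Let F : {linear U -> V} := HB.pack f (GRing.isLinear.Build rat U V _ f lf).

Lemma lin0 : f 0 = 0. Proof. exact: (linear0 F). Qed.
Lemma linD u v : f (u + v) = f u + f v. Proof. exact: (linearD F). Qed.
Lemma linB u v : f (u - v) = f u - f v. Proof. exact: (linearB F). Qed.
Lemma linN u : f (- u) = - f u. Proof. exact: (linearN F). Qed.
Lemma linZ a u : f (a *: u) = a *: f u. Proof. exact: (linearZ_LR F). Qed.
Lemma lin_sum (J : Type) (r : seq J) (P : pred J) (G : J -> U) :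
  f (\sum_(j <- r | P j) G j) = \sum_(j <- r | P j) f (G j).
Proof. exact: (linear_sum F). Qed.

End Linear.

(** [fil n] stands for the vectors of order at least [n].  Completeness is a
separate notion relative to a subset ([complete_on]): an element of a completed free
Lie algebra has finitely many degrees, so only series of a fixed degree
converge there. *)
Record filtration (V : lmodType rat) := Filtration {
  fil :> nat -> V -> Prop;
  fil_all : forall v, fil 0%N v;
  fil_zero : forall n, fil n 0;
  filP : forall n a u v, fil n u -> fil n v -> fil n (a *: u + v);
  filW : forall n v, fil n.+1 v -> fil n v;
  fil_sep : forall v, (forall n, fil n v) -> v = 0
}.

Section Filtration.
Variables (V : lmodType rat) (F : filtration V).
Implicit Types (u v : V).

Lemma filD n u v : F n u -> F n v -> F n (u + v).
Proof. by move=> Fu Fv; rewrite -[u]scale1r; apply: filP. Qed.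

Lemma filZ n a u : F n u -> F n (a *: u).
Proof. by move=> Fu; rewrite -[a *: u]addr0; apply: filP => //; apply: fil_zero. Qed.

Lemma filN n u : F n u -> F n (- u).
Proof. by rewrite -scaleN1r; apply: filZ. Qed.

Lemma filB n u v : F n u -> F n v -> F n (u - v).
Proof. by move=> Fu Fv; apply: filD => //; apply: filN. Qed.

Lemma fil_sum n (J : Type) (r : seq J) (P : pred J) (G : J -> V) :
  (forall j, P j -> F n (G j)) -> F n (\sum_(j <- r | P j) G j).
Proof. by move=> FG; elim/big_ind: _ => //; [apply: fil_zero | apply: filD]. Qed.

Lemma fil_le m n v : (m <= n)%N -> F n v -> F m v.
Proof.
by move/subnKC <-; elim: (n - m)%N => [|k IH]; rewrite ?addn0 // addnS => /filW.
Qed.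

Lemma fil_eq u v : (forall n, F n (u - v)) -> u = v.
Proof. by move=> Fuv; apply/eqP; rewrite -subr_eq0; apply/eqP/(fil_sep Fuv). Qed.

Definition converges (x : nat -> V) (S : V) : Prop :=
  forall k, F k (S - \sum_(m < k) x m).

Definition complete_on (H : V -> Prop) : Prop := forall x : nat -> V,
  (forall m, H (x m)) -> (forall m, F m (x m)) ->
  exists2 S, H S & converges x S.

Lemma converges_uniq x S S' : converges x S -> converges x S' -> S = S'.
Proof.
move=> cS cS'; apply: fil_eq => n.
by move: (filB (cS n) (cS' n)); rewrite opprB addrA subrK.
Qed.

Definition raising (f : V -> V) : Prop := forall n v, F n v -> F n.+1 (f v).

Lemma raising_iter f n v : raising f -> F n (iter n f v).
Proof. by move=> Ff; elim: n => [|n IH]; [apply: fil_all | apply: Ff]. Qed.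

(** A relation rather than a function, so that the exponential of an operator makes
sense before convergence is known. *)
Definition exp_maps (f : V -> V) (v w : V) : Prop :=
  converges (fun k => (k`!%:R)^-1 *: iter k f v) w.

End Filtration.

Lemma converges_map (U V : lmodType rat) (F : filtration U) (G : filtration V)
    (f : U -> V) u S : linear f -> (forall n v, F n v -> G n (f v)) ->
  converges F u S -> converges G (fun k => f (u k)) (f S).
Proof. by move=> lf Ff cS k; rewrite -(lin_sum lf) -(linB lf); exact: (Ff _ _ (cS k)). Qed.

Section Length.
Variable T : eqType.

Definition len_fil (n : nat) (s : ncseries T) : Prop :=
  forall w, (size w < n)%N -> s w = 0.

Lemma len_filP n a s r : len_fil n s -> len_fil n r -> len_fil n (a *: s + r).
Proof. by move=> ls lr w lw; rewrite ncPE ls // lr // mulr0 addr0. Qed.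

Lemma len_filW n s : len_fil n.+1 s -> len_fil n s.
Proof. by move=> ls w lw; apply: ls; apply: ltnW. Qed.

Lemma len_fil_sep s : (forall n, len_fil n s) -> s = 0.
Proof. by move=> ls; apply/funext => w; apply: (ls (size w).+1). Qed.

Definition length_filtration : filtration (ncseries T) :=
  @Filtration (ncseries T) len_fil (fun v w (lw : (size w < 0)%N) => ltac:(by []))
    (fun n w _ => erefl) len_filP len_filW len_fil_sep.

Lemma len_fil_smul m n (s r : ncseries T) :
  len_fil m s -> len_fil n r -> len_fil (m + n) (smul s r).
Proof.
move=> ls lr w lw; rewrite /smul big1 // => k _.
have kw : (k <= size w)%N by rewrite -ltnS.
have [km|mk] := ltnP k m; first by rewrite ls ?mul0r // size_takel.
rewrite lr ?mulr0 // size_drop ltn_subLR //.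
by apply: leq_trans lw _; rewrite leq_add2r.
Qed.

Lemma len_fil_spow k (s : ncseries T) : s [::] = 0 -> len_fil k (spow s k).
Proof.
move=> s0; elim: k => [|k IH] //.
by apply: (@len_fil_smul 1 k) => // -[].
Qed.

(** A power of a series without constant term vanishes on short words, so the
truncated sums in [sexp] are the partial sums of the exponential series. *)
Lemma converges_sexp (s : ncseries T) : s [::] = 0 ->
  converges length_filtration (fun k => (k`!%:R)^-1 *: spow s k) (sexp s).
Proof.
move=> s0 n w lw; rewrite addrfctE opprfctE fct_sumE.
apply/eqP; rewrite subr_eq0 /sexp (big_ord_widen n (fun k => (k`!%:R)^-1 * spow s k w)) //.
rewrite big_mkcond; apply/eqP/eq_bigr => k _.
by case: ltnP => // wk; rewrite ncZE (len_fil_spow s0) ?mulr0.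
Qed.

End Length.

(** * Substituting operators for letters *)

Section Substitution.
Variables (T : finType) (V : lmodType rat) (F : filtration V) (op : T -> V -> V).
Hypothesis op_lin : forall i, linear (op i).
Hypothesis op_raising : forall i, raising F (op i).
Implicit Types (s r : ncseries T) (v : V).

(** [ev s] is the operator obtained from the series [s] by substituting [op i] for
each letter [i].  Splitting off the first letter of each word gives a
recursion that determines [ev] as the [op i] raise the order; every
property below is read off from it without handling sums over words. *)
Definition is_eval (ev : ncseries T -> V -> V) : Prop := forall s v,
  ev s v = s [::] *: v + \sum_i op i (ev (sshift i s) v).

Lemma eval_exists : complete_on F (fun=> True) -> exists ev, is_eval ev.
Proof.
move=> cF.
pose fix ev (k : nat) (s : ncseries T) (v : V) {struct k} : V :=
  if k is k'.+1 then s [::] *: v + \sum_i op i (ev k' (sshift i s) v) else 0.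
have evF k s v : F k (ev k.+1 s v - ev k s v).
  elim: k s => [|k IH] s; first exact: fil_all.
  rewrite [ev k.+2 s v]/= [ev k.+1 s v in X in F _ X]/= opprD addrACA subrr add0r.
  rewrite -sumrB; apply: fil_sum => i _.
  by rewrite -linB //; apply/op_raising/IH.
have lim sv : exists S, forall k, F k (S - ev k sv.1 sv.2).
  have [|//|S _ cS] := cF (fun k => ev k.+1 sv.1 sv.2 - ev k sv.1 sv.2); first by [].
  exists S => k; have := cS k.
  suff -> : \sum_(m < k) (ev m.+1 sv.1 sv.2 - ev m sv.1 sv.2) = ev k sv.1 sv.2 by [].
  elim: k => [|k IH]; first by rewrite big_ord0.
  rewrite big_ord_recr IH [LHS]addrC; exact: subrK.
have [S SP] := choice lim.
exists (fun s v => S (s, v)) => s v; apply: (fil_eq (F := F)) => -[|n]; first exact: fil_all.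
rewrite -[X in X - _](subrK (ev n.+1 s v)) -addrA; apply: filD; first exact: (SP (s, v)).
rewrite [ev _ _ _]/= opprD addrACA subrr add0r -sumrB; apply: fil_sum => i _.
rewrite -linB //; apply: op_raising; rewrite -opprB; apply: filN.
exact: (SP (sshift i s, v)).
Qed.

(** The uniqueness principle behind all identities between substitutions: a
family that is expressed through itself by operators raising the order has
infinite order. *)
Lemma contraction_eq0 (J : Type) (sigma : T -> J -> J) (D : J -> V) :
  (forall j, D j = \sum_i op i (D (sigma i j))) -> forall j, D j = 0.
Proof.
move=> DE j; apply: (fil_sep (f := F)) => n.
elim: n j => [|n IH] j; first exact: fil_all.
by rewrite DE; apply: fil_sum => i _; apply: op_raising.
Qed.

Variable ev : ncseries T -> V -> V.
Hypothesis evE : is_eval ev.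

Lemma eval_uniq (v : V) (f : ncseries T -> V) :
  (forall s, f s = s [::] *: v + \sum_i op i (f (sshift i s))) ->
  forall s, f s = ev s v.
Proof.
move=> fE s; apply/eqP; rewrite -subr_eq0; apply/eqP; move: s.
apply: (contraction_eq0 (sigma := @sshift T)) => s.
rewrite evE fE opprD addrACA subrr add0r -sumrB.
by apply: eq_bigr => i _; rewrite linB.
Qed.

Lemma eval_linear s : linear (ev s).
Proof.
move=> a u v; apply/esym; move: s.
apply: eval_uniq => s; rewrite !evE !scalerDr !scalerA [a * _]mulrC.
rewrite addrACA; congr (_ + _).
by rewrite scaler_sumr -big_split; apply: eq_bigr => i _; rewrite op_lin.
Qed.

Lemma eval_linearl v : linear (ev^~ v).
Proof.
move=> a s r; apply/eqP; rewrite -subr_eq0; apply/eqP.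
pose D (p : ncseries T * ncseries T) := ev (a *: p.1 + p.2) v - (a *: ev p.1 v + ev p.2 v).
suff /(_ (s, r)) : forall p, D p = 0 by [].
apply: (contraction_eq0 (sigma := fun i p => (sshift i p.1, sshift i p.2))) => {s r} [[s r]].
rewrite /D /= !evE ncPE !scalerDr !scalerDl scalerA.
rewrite [X in _ - X]addrACA opprD addrACA subrr add0r.
rewrite scaler_sumr -big_split -sumrB; apply: eq_bigr => i _.
by rewrite /= linB // op_lin.
Qed.

(** Both sides satisfy the same recursion in [s], because the left derivative of a
product is [s [::] *: sshift i r + smul (sshift i s) r]. *)
Lemma eval_mul s r v : ev (smul s r) v = ev s (ev r v).
Proof.
apply/eqP; rewrite -subr_eq0; apply/eqP; move: s.
apply: (contraction_eq0 (sigma := @sshift T)) => s.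
rewrite (evE (smul s r)) smul_nil (evE s).
under eq_bigr => i _ do rewrite sshift_smul (eval_linearl v) op_lin.
rewrite big_split -scaler_sumr /= addrA -scalerA -scalerDr -evE opprD addrACA subrr add0r.
by rewrite -sumrB; apply: eq_bigr => i _; rewrite linB.
Qed.

Lemma eval1 v : ev (@sone T) v = v.
Proof.
rewrite evE scale1r big1 ?addr0 // => i _.
by rewrite (lin0 (eval_linearl v)) lin0.
Qed.

Lemma eval_letter i v : ev (sletter i) v = op i v.
Proof.
rewrite evE scale0r add0r (bigD1 i) //= big1 ?addr0 => [|j ji].
  congr (op i _); rewrite -[RHS]eval1; congr (ev _ v); apply/funext => w.
  by rewrite /sshift /sletter eqseq_cons eqxx.
have -> : sshift j (sletter i) = 0.
  by apply/funext => w; rewrite /sshift /sletter eqseq_cons (negbTE ji).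
by rewrite (lin0 (eval_linearl v)) lin0.
Qed.

Lemma eval_fil m n s v : len_fil m s -> F n v -> F (m + n)%N (ev s v).
Proof.
move=> ls Fv; elim: m s ls => [|m IH] s ls.
  suff: forall k, (k <= n)%N -> forall r, F k (ev r v) by move/(_ n (leqnn n) s).
  elim=> [|k IH] kn r; first exact: fil_all.
  rewrite evE; apply: filP; first exact: fil_le Fv.
  by apply: fil_sum => i _; apply/op_raising/IH/ltnW.
rewrite evE ls // scale0r add0r; apply: fil_sum => i _.
by apply/op_raising/IH => w lw; apply: ls.
Qed.

Lemma eval_spow k s v : ev (spow s k) v = iter k (ev s) v.
Proof. by elim: k => [|k IH]; rewrite ?eval1 //= eval_mul IH. Qed.

Lemma eval_sexp s v : s [::] = 0 -> exp_maps F (ev s) v (ev (sexp s) v).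
Proof.
move=> s0.
have evF n r : length_filtration T n r -> F n (ev r v).
  by move=> lr; rewrite -[n]addn0; apply: eval_fil => //; apply: fil_all.
move=> n; have := converges_map (eval_linearl v) evF (converges_sexp s0) n.
by under eq_bigr => k _ do rewrite (linZ (eval_linearl v)) eval_spow.
Qed.

End Substitution.

(** * Intervals and the gauge action *)

Section Extension.
Variables (V : lmodType rat) (F : filtration V).
Local Notation V' := (V * rat^o)%type.
Implicit Types (p q : V').

(** The pair [(v, t)] stands for [v + t d] where [d] is a formal differential
adjoined to [V].  Orders in [V] are shifted by one and [d] has order 0, so that
the bracket with [e] raises the order: it sends [d] to [- d e], which may have
order 0 in [V]. *)
Definition ext_fil (n : nat) p : Prop :=
  if n is m.+1 then F m p.1 /\ p.2 = 0 else True.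

Lemma ext_fil_zero n : ext_fil n 0.
Proof. by case: n => // n; split => //; apply: fil_zero. Qed.

Lemma ext_filP n a p q : ext_fil n p -> ext_fil n q -> ext_fil n (a *: p + q).
Proof.
case: n => // n [Fp p0] [Fq q0]; split; first exact: filP.
by rewrite /= p0 q0 scaler0 addr0.
Qed.

Lemma ext_filW n p : ext_fil n.+1 p -> ext_fil n p.
Proof. by case: n => // n [/filW]. Qed.

Lemma ext_fil_sep p : (forall n, ext_fil n p) -> p = 0.
Proof.
move=> Fp; rewrite [p]surjective_pairing (Fp 1).2 (fil_sep (f := F) (v := p.1)) // => n.
by have [] := Fp n.+1.
Qed.

Definition ext_filtration : filtration V' :=
  @Filtration V' ext_fil (fun=> I) ext_fil_zero ext_filP ext_filW ext_fil_sep.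

Lemma ext_complete :
  complete_on F (fun=> True) -> complete_on ext_filtration (fun=> True).
Proof.
move=> cF x _ Fx.
have [//||S _ cS] := cF (fun m : nat => (x m.+1).1); first by move=> m; have [] := Fx m.+1.
exists ((x 0%N).1 + S, (x 0%N).2) => // -[//|k].
rewrite big_ord_recl; set s := \sum_(m < k) _.
have s1 : s.1 = \sum_(m < k) (x m.+1).1 by rewrite /s raddf_sum.
have s2 : s.2 = 0.
  by rewrite /s raddf_sum big1 // => m _; have [] := Fx (lift ord0 m).
split; last by rewrite -[LHS]/((x 0%N).2 - ((x 0%N).2 + s.2)) s2 addr0 subrr.
rewrite -[X in F k X]/((x 0%N).1 + S - ((x 0%N).1 + s.1)) s1.
by rewrite opprD addrA [_ + S]addrC addrK; apply: cS.
Qed.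

(** The bracket with [e] on [v + t d], where [X] is the bracket with [e] on [V]
and [g = d e]; the bracket of [e] with [d] is [- d e]. *)
Definition gauge_op (X : V -> V) (g : V) p : V' := (X p.1 - p.2 *: g, 0).

Variables (X : V -> V) (g : V).
Hypotheses (X_lin : linear X) (X_raising : raising F X).

Lemma gauge_op_lin : linear (gauge_op X g).
Proof.
move=> a p q; rewrite [RHS]surjective_pairing; congr (_, _); last by rewrite /= scaler0 addr0.
by rewrite /= X_lin scalerDl opprD addrACA -scalerA -scalerBr.
Qed.

Lemma gauge_op_raising : raising ext_filtration (gauge_op X g).
Proof.
move=> [|n] p.
  by move=> _; split => //; apply: fil_all.
case=> Fp p0; split => //=.
by rewrite p0 scale0r subr0; apply: X_raising.
Qed.

End Extension.

Section OneVariable.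
Implicit Types (s r : ncseries unit).

Lemma unit_word_size (w v : seq unit) : size w = size v -> w = v.
Proof. by elim: w v => [|[] w IH] [|[] v] //= [/IH ->]. Qed.

Lemma sum_unit (V : zmodType) (G : unit -> V) : \sum_i G i = G tt.
Proof. by rewrite (big_pred1 tt) // => -[]. Qed.

Lemma smulC s r : smul s r = smul r s.
Proof.
apply/funext => w; rewrite /smul (reindex_inj rev_ord_inj); apply: eq_bigr => k _ /=.
have kw : (k <= size w)%N by rewrite -ltnS.
rewrite mulrC subSS; congr (r _ * s _); apply: unit_word_size.
  by rewrite size_drop size_takel // subKn.
by rewrite size_drop size_takel // leq_subr.
Qed.

Definition bernoulli_series : ncseries unit :=
  fun w => bernoulli (size w) / (size w)`!%:R.

(** [x / (exp x - 1)] times [(exp x - 1) / x] is 1; the left derivative of [exp x]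
is [(exp x - 1) / x]. *)
Lemma bernoulli_seriesV :
  smul bernoulli_series (sshift tt (sexp (sletter tt))) = @sone unit.
Proof.
apply/funext => w; rewrite /sone -size_eq0 -bernoulli_rec; apply: eq_bigr => k _.
rewrite /bernoulli_series /sshift sexp_sletter /= size_drop size_takel -1?ltnS //.
by rewrite subSn // -ltnS.
Qed.

End OneVariable.

Section OneOperator.
Variables (V : lmodType rat) (F : filtration V) (X : V -> V).
Hypotheses (X_lin : linear X) (X_raising : raising F X).
Variable ev : ncseries unit -> V -> V.
Hypothesis evE : is_eval (fun=> X) ev.

Lemma eval_series (s : ncseries unit) v :
  converges F (fun i => s (nseq i tt) *: iter i X v) (ev s v).
Proof.
have Xl : forall i : unit, linear X by [].
have Xr : forall i : unit, raising F X by [].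
have evF n r : length_filtration unit n r -> F n (ev r v).
  by move=> lr; rewrite -[n]addn0; apply: (eval_fil Xr evE lr (fil_all F v)).
have evl : linear (ev^~ v) by apply: (eval_linearl (F := F) (op := fun=> X)).
move=> n.
have -> : \sum_(m < n) s (nseq m tt) *: iter m X v
    = ev (\sum_(m < n) s (nseq m tt) *: spow (sletter tt) m) v.
  rewrite (lin_sum evl); apply: eq_bigr => k _.
  rewrite (linZ evl) (eval_spow (F := F) Xl Xr evE); congr (_ *: _).
  apply/esym/eq_iter => u.
  exact: (eval_letter (F := F) Xl Xr evE).
rewrite -(linB evl); apply: evF => w lw.
rewrite addrfctE opprfctE fct_sumE (bigD1 (Ordinal lw)) //= big1 ?addr0.
  rewrite ncZE spow_sletter eqxx mulr1.
  by rewrite (unit_word_size (w := nseq _ _) (v := w)) ?size_nseq // subrr.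
move=> k; rewrite -val_eqE ncZE spow_sletter eq_sym => /negbTE -> /=.
by rewrite mulr0.
Qed.

End OneOperator.

Lemma exp_maps_letter (T : finType) (V : lmodType rat) (F : filtration V)
    (op : T -> V -> V) (ev : ncseries T -> V -> V) :
  (forall i, linear (op i)) -> (forall i, raising F (op i)) -> is_eval op ev ->
  forall i v, exp_maps F (op i) v (ev (sexp (sletter i)) v).
Proof.
move=> op_lin op_raising evE i v.
have := eval_sexp op_lin op_raising evE v (s := sletter i) erefl.
by congr (exp_maps _ _ _ _); apply/funext => u; rewrite (eval_letter op_lin op_raising evE).
Qed.

Section Gauge.
Variables (V : lmodType rat) (F : filtration V) (X : V -> V) (g : V).
Hypotheses (X_lin : linear X) (X_raising : raising F X).
Hypothesis F_complete : complete_on F (fun=> True).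

(** Applying [exp] of the bracket with [e] to [b + d] gives
[exp X b - (exp X - 1) / X g + d].  That this equals [a + d] is the formula
[g - X b = X / (exp X - 1) (b - a)] multiplied by the invertible series
[(exp X - 1) / X]. *)
Theorem gaugeP a b :
  exp_maps (ext_filtration F) (gauge_op X g) (b, 1) (a, 1) <->
  converges F (fun i => (bernoulli i / i`!%:R) *: iter i X (b - a)) (g - X b).
Proof.
have Xl : forall i : unit, linear X by [].
have Xr : forall i : unit, raising F X by [].
have [ev evE] := eval_exists Xl Xr F_complete.
have ev_mul := eval_mul Xl Xr evE.
have ev_lin := eval_linear Xl Xr evE.
set T := gauge_op X g.
have Tl : forall i : unit, linear T by move=> _; apply: gauge_op_lin.
have Tr : forall i : unit, raising (ext_filtration F) T by move=> _; apply: gauge_op_raising.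
(* Substituting the bracket with [e] on the extended space: a positive power of it
   sends [(v, t)] to [X ^ k v - t X ^ (k - 1) g] in [V]. *)
pose evT (s : ncseries unit) (p : V * rat^o) : V * rat^o :=
  (ev s p.1 - p.2 *: ev (sshift tt s) g, s [::] *: p.2).
have evTE : is_eval (fun=> T) evT.
  move=> s p; rewrite sum_unit; congr (_, _); last by rewrite addr0.
  rewrite /= evE sum_unit (linB X_lin) (linZ X_lin).
  rewrite (evE (sshift tt s)) sum_unit.
  rewrite -addrA scalerDr [X in _ - X]addrC opprD addrA.
  by rewrite -!addrA scalerA mulrC.
set x := sletter tt; set phi := sshift tt (sexp x).
have expT := exp_maps_letter Tl Tr evTE tt (b, 1).
rewrite -/x /evT /= -/phi in expT.
have e1 : sexp x [::] = 1 :> rat by rewrite sexp_sletter /= invr1.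
rewrite e1 !scale1r in expT.
have expb : ev (sexp x) b = b + ev phi (X b).
  rewrite evE e1 scale1r sum_unit; congr (_ + _).
  by rewrite -!(eval_letter Xl Xr evE tt) -!ev_mul smulC.
have phiK v : ev bernoulli_series (ev phi v) = v.
  by rewrite -ev_mul bernoulli_seriesV (eval1 Xl Xr evE).
have betaK v : ev phi (ev bernoulli_series v) = v.
  by rewrite -ev_mul smulC bernoulli_seriesV (eval1 Xl Xr evE).
have betaP := eval_series X_lin X_raising evE bernoulli_series.
have betaE v w : converges F (fun i => (bernoulli i / i`!%:R) *: iter i X v) w <->
    ev bernoulli_series v = w.
  have cv : converges F (fun i => (bernoulli i / i`!%:R) *: iter i X v) (ev bernoulli_series v).
    move=> n; have := betaP v n.
    by under eq_bigr => k _ do rewrite /bernoulli_series size_nseq.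
  by split=> [/(converges_uniq cv)|<-].
have key : ev (sexp x) b - ev phi g = b - ev phi (g - X b).
  by rewrite expb (linB (ev_lin phi)) opprB addrA.
rewrite key in expT; rewrite betaE; split.
  by move/(converges_uniq expT) => [] <-; rewrite subKr phiK.
by move=> ba; move: expT; rewrite -ba betaK subKr.
Qed.

End Gauge.

(** * The differential equation of an exponential *)

Lemma divided_power (U : lmodType rat) (f : U -> U) (v : U) m : linear f ->
  f ((m`!%:R)^-1 *: iter m f v) = m.+1%:R *: ((m.+1`!%:R)^-1 *: iter m.+1 f v).
Proof.
move=> lf; rewrite (linZ lf) scalerA factS natrM invfM mulrA divff ?mul1r //.
by rewrite Num.Theory.pnatr_eq0.
Qed.

Section Leibniz.
Variables (P V : lmodType rat) (G : filtration P) (F : filtration V).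
Variables (mu : P -> V -> V) (T : P -> P) (L : V -> V).
Hypotheses (mu_linl : forall r, linear (mu^~ r)) (mu_linr : forall p, linear (mu p)).
Hypothesis mu_fil : forall m n p r, G m p -> F n r -> F (m.-1 + n)%N (mu p r).
Hypotheses (T_lin : linear T) (L_lin : linear L) (T_raising : raising G T) (L_raising : raising F L).
Hypothesis muL : forall p r, L (mu p r) = mu (T p) r + mu p (L r).

(** If [L] is a derivation with respect to [mu], that is, if [L] acts on a product
[mu p r] through [T] on [p] and [L] on [r], then the exponential of [L] is
multiplicative for [mu].  With divided powers the [n]-th term of the exponential series of
[L] at [mu p r] is the convolution [c n] of the two exponential series.  The
predecessor in [mu_fil] allows for the shift of orders in [ext_filtration]. *)
Lemma exp_maps_bilinear p q r s :
  exp_maps G T p q -> exp_maps F L r s -> exp_maps F L (mu p r) (mu q s).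
Proof.
pose pm m := (m`!%:R)^-1 *: iter m T p; pose rm m := (m`!%:R)^-1 *: iter m L r.
pose c n := \sum_(m < n.+1) mu (pm m) (rm (n - m)%N).
have pmS m : T (pm m) = m.+1%:R *: pm m.+1 by apply: divided_power.
have rmS m : L (rm m) = m.+1%:R *: rm m.+1 by apply: divided_power.
have cS n : L (c n) = n.+1%:R *: c n.+1.
  rewrite (lin_sum L_lin).
  transitivity (\sum_(m < n.+2) m%:R *: mu (pm m) (rm (n.+1 - m)%N)
     + \sum_(m < n.+2) (n.+1 - m)%:R *: mu (pm m) (rm (n.+1 - m)%N)).
    rewrite [X in _ = X + _]big_ord_recl mulr0n scale0r add0r.
    rewrite [X in _ = _ + X]big_ord_recr /= subnn scale0r addr0.
    rewrite -big_split; apply: eq_bigr => m _; rewrite muL pmS rmS.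
    by rewrite (linZ (mu_linl (rm (n - m)%N))) (linZ (mu_linr (pm m))) -subSn -1?ltnS.
  rewrite -big_split scaler_sumr; apply: eq_bigr => m _ /=.
  by rewrite -scalerDl -natrD subnKC // -ltnS.
have cE n : (n`!%:R)^-1 *: iter n L (mu p r) = c n.
  elim: n => [|n IH]; first by rewrite /c big_ord1 /pm /rm fact0 invr1 !scale1r.
  apply: (scalerI (_ : n.+1%:R != 0)); first by rewrite Num.Theory.pnatr_eq0.
  by rewrite -divided_power // IH cS.
pose B n := \sum_(j < n) rm j.
(* Summing the triangle of the first [n] convolutions by rows avoids comparing it
   with a square of products. *)
have cB n : \sum_(k < n) c k = \sum_(m < n) mu (pm m) (B (n - m)%N).
  elim: n => [|n IH]; first by rewrite !big_ord0.
  rewrite big_ord_recr IH /c /=.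
  rewrite [X in X + _](_ : _ = \sum_(m < n.+1) mu (pm m) (B (n - m)%N)); last first.
    by rewrite [RHS]big_ord_recr /= subnn [B 0%N]big_ord0 (lin0 (mu_linr _)) addr0.
  rewrite -big_split; apply: eq_bigr => m _ /=.
  by rewrite subSn -1?ltnS // [B _.+1]big_ord_recr (linD (mu_linr _)).
move=> cq cs k.
under eq_bigr => n _ do rewrite cE.
have -> : \sum_(n < k) c n = \sum_(n < k.+1) c n - c k by rewrite big_ord_recr /= addrK.
rewrite opprB addrCA; apply: filD.
  by rewrite -cE; apply: filZ; apply: raising_iter.
rewrite cB -[X in X - _](subrK (mu (\sum_(m < k.+1) pm m) s)) -addrA.
apply: filD.
  by have := mu_fil (cq k.+1) (fil_all F s); rewrite addn0 (linB (mu_linl s)).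
rewrite (lin_sum (mu_linl s)) -sumrB; apply: fil_sum => m _.
rewrite -(linB (mu_linr _)).
have /mu_fil /(_ (cs (k.+1 - m)%N)) : G m (pm m) by apply/filZ/raising_iter.
apply: fil_le; case: (m : nat) (ltn_ord m) => [|j] jk; first by rewrite leqW.
by rewrite subSS /= subnKC // ltnW.
Qed.

End Leibniz.

Section ExpEquation.
Variable T : eqType.
Local Notation len := (length_filtration T).
Implicit Types (s r W : ncseries T).

Definition sad W r : ncseries T := smul W r - smul r W.

Lemma sad_lin W : linear (sad W).
Proof.
move=> a u v; rewrite /sad smulPr smulPl.
by rewrite opprD addrACA -scalerN -scalerDr.
Qed.

Lemma smul_linl r : linear (fun s => smul s r).
Proof. by move=> a s s'; apply: smulPl. Qed.

Lemma smul_linr s : linear (smul s).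
Proof. by move=> a r r'; apply: smulPr. Qed.

Lemma seuler_lin : linear (@seuler T).
Proof. by move=> a s r; apply/funext => w; rewrite ncPE /seuler mulrDr mulrCA. Qed.

Lemma length_complete : complete_on len (fun=> True).
Proof.
move=> x _ xF.
exists (fun w => \sum_(m < (size w).+1) x m w) => // k w wk.
rewrite addrfctE opprfctE fct_sumE.
rewrite (big_ord_widen k (fun m => x m w)) // big_mkcond; apply/eqP.
rewrite subr_eq0; apply/eqP/eq_bigr => m _; case: ltnP => // wm.
by rewrite xF.
Qed.

Variable W : ncseries T.
Hypothesis W0 : W [::] = 0.

Lemma len_fil1 : len_fil 1 W. Proof. by case. Qed.

Lemma sad_raising : raising len (sad W).
Proof.
move=> n r Fr; apply: (filB (F := len)); first exact: (len_fil_smul len_fil1 Fr).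
by rewrite -addn1; apply: (len_fil_smul Fr len_fil1).
Qed.

Lemma exp_maps_smul r : exp_maps len (smul W) r (smul (sexp W) r).
Proof.
have Ff n v : len n v -> len n (smul v r).
  by move=> Fv; rewrite -[n]addn0; apply: len_fil_smul.
move=> n; have := converges_map (smul_linl r) Ff (converges_sexp W0) n.
have -> // : \sum_(m < n) smul ((m`!%:R)^-1 *: spow W m) r =
   \sum_(m < n) (m`!%:R)^-1 *: iter m (smul W) r.
apply: eq_bigr => m _; rewrite (linZ (smul_linl r)); congr (_ *: _).
by elim: (m : nat) => [|j IH]; rewrite ?smul1s //= -IH smulA.
Qed.

(** By [gaugeP] with the Euler derivation [E] as differential, conjugation by
[exp W] takes [E + b] to [E + a].  Let [v + t E] act on series by left
multiplication with [v] and by [E].  Then [exp W (E + b) r = (E + a) (exp W r)] by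
[exp_maps_bilinear], and [r = 1] is the claim. *)
Theorem seuler_sexp a b :
  converges len (fun i => (bernoulli i / i`!%:R) *: iter i (sad W) (b - a))
    (seuler W - sad W b) ->
  seuler (sexp W) = smul (sexp W) b - smul a (sexp W).
Proof.
move/(gaugeP (seuler W) (sad_lin W) sad_raising length_complete) => eT.
pose mu (p : ncseries T * rat^o) r : ncseries T := smul p.1 r + p.2 *: seuler r.
have mul p : linear (mu p).
  move=> c u v; rewrite /mu smulPr seuler_lin !scalerDr !scalerA [c * p.2]mulrC.
  by rewrite addrACA.
have mulr r : linear (mu^~ r).
  by move=> c u v; rewrite /mu smulPl scalerDl !scalerDr !scalerA addrACA.
have euF n r : len n r -> len n (seuler r).
  by move=> Fr w /Fr e; rewrite /seuler e mulr0.
have muF m n p r : ext_filtration len m p -> len n r -> len (m.-1 + n)%N (mu p r).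
  case: m => [|m] Fp Fr; last first.
    by rewrite /mu Fp.2 scale0r addr0; apply: len_fil_smul Fr; apply: Fp.1.
  apply: (filD (F := len)); first by apply: (@len_fil_smul _ 0).
  by apply: (filZ (F := len)); apply: euF.
have smulW_lin := smul_linr W.
have smulW_r : raising len (smul W) by move=> n r; apply: len_fil_smul len_fil1.
have Tl := gauge_op_lin (seuler W) (sad_lin W).
have Tr := gauge_op_raising (seuler W) sad_raising.
have muL p r : smul W (mu p r) = mu (gauge_op (sad W) (seuler W) p) r + mu p (smul W r).
  rewrite /mu /gauge_op /= scale0r addr0 seuler_smul.
  rewrite (linD smulW_lin) (linZ smulW_lin) /sad !(linB (smul_linl r)).
  rewrite (linZ (smul_linl r)) !smulA scalerDr !addrA; congr (_ + _).
  by rewrite [X in _ = X + _]addrAC !subrK.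
have e1 : exp_maps len (smul W) (@sone T) (sexp W).
  by have := exp_maps_smul (@sone T); rewrite smuls1.
have := exp_maps_bilinear mulr mul muF Tl smulW_lin Tr smulW_r muL eT e1.
have -> : mu (b, 1) (@sone T) = b.
  rewrite /mu smuls1 scale1r [X in _ + X](_ : _ = 0) ?addr0 //.
  by apply/funext => -[|i w]; rewrite /seuler /sone ?mul0r ?mulr0.
move/(converges_uniq (exp_maps_smul b)) => ->.
by rewrite /mu /= scale1r addrAC subrr add0r.
Qed.

End ExpEquation.

(** * Free Lie algebras with finitely many generators *)

Section LieLinear.
Variable L : gradedLieType.
Implicit Types x y z : L.

Lemma lbr_linl z : linear (fun x => lbr x z).
Proof. exact: lbr_linearl. Qed.

Lemma lbr_linr z : linear (lbr z).
Proof. exact: lbr_linearr. Qed.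

Lemma lbr_jacobi0 x y z : hdeg 0 x -> hdeg 0 y ->
  lbr (lbr x y) z = lbr x (lbr y z) - lbr y (lbr x z).
Proof.
move=> x0 y0; have [s [c [cP ->]]] := hdeg_span z.
rewrite !(lin_sum (lbr_linr _)) -sumrB; apply: eq_bigr => d _.
by rewrite (lbr_jacobi _ _ _ _ _ _ x0 y0 (cP d)) mul0r expr0z scale1r.
Qed.

Lemma lbr_anti0 x y : hdeg 0 x -> hdeg 0 y -> lbr y x = - lbr x y.
Proof. by move=> x0 y0; rewrite (lbr_anti _ _ _ _ x0 y0) mul0r expr0z scale1r. Qed.

Lemma lbr00 x : hdeg 0 x -> lbr x x = 0.
Proof.
move=> x0; have /eqP := lbr_anti0 x0 x0.
rewrite -subr_eq0 opprK -mulr2n -scaler_nat scaler_eq0.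
by rewrite Num.Theory.pnatr_eq0 => /eqP.
Qed.

End LieLinear.

Section Decomposition.
Variables (I : choiceType) (dg : I -> int) (gs : seq I).
Hypotheses (gs_uniq : uniq gs) (gs_all : forall i, i \in gs).
Local Notation L := (freeLie dg).
Local Notation word_class t := (fl_pi dg (mono t)).
Local Notation letter i := (fl_pi dg (mono (Gen i))).
Local Notation piece n d := (fun t : word I => (brackets t == n) && (wdeg dg t == d)).

Lemma word_classBr t u : word_class (Br t u) = lbr (word_class t) (word_class u) :> L.
Proof. by rewrite -mbrUU [lbr _ _]fl_br_pi. Qed.

Lemma word_class_spanned t : spanned (piece (brackets t) (wdeg dg t)) (word_class t).
Proof. by exists (mono t) => //; apply: supp_inU; rewrite /= !eqxx. Qed.

Lemma piece_br m n c d (x y : L) : spanned (piece m c) x -> spanned (piece n d) y ->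
  spanned (piece (m + n).+1 (c + d)) (lbr x y).
Proof. by apply: spanned_br => t u /andP[/eqP<- /eqP<-] /andP[/eqP<- /eqP<-]; rewrite /= !eqxx. Qed.

Lemma piece_deg n d (x : L) : spanned (piece n d) x -> hdeg d x.
Proof. by apply: spannedS => t /andP[]. Qed.

(** The Jacobi identity moves brackets to the right: a bracket with a word is a sum
of brackets with single letters.  The number of brackets is tracked so that the
decomposition extends to the completion. *)
Lemma word_bracket_decomp t m d (y : L) : spanned (piece m d) y ->
  exists2 u : I -> L,
    forall i, spanned (piece (brackets t + m)%N (wdeg dg t + d - dg i)) (u i) &
    lbr (word_class t) y = \sum_(i <- gs) lbr (letter i) (u i).
Proof.
elim: t m d y => [i|t IHt u IHu] m d y yP.
  exists (fun j => if j == i then y else 0).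
    move=> j; case: eqP => [->|_]; last exact: spanned0.
    by rewrite add0n /= [dg i + d]addrC addrK.
  rewrite (bigD1_seq i) //= eqxx big1 ?addr0 // => j /negbTE ->.
  exact: (lin0 (lbr_linr _)).
have uy := piece_br (word_class_spanned u) yP; have ty := piece_br (word_class_spanned t) yP.
have [v1 v1P e1] := IHt _ _ _ uy; have [v2 v2P e2] := IHu _ _ _ ty.
exists (fun i => - (-1) ^ (wdeg dg t * wdeg dg u) *: v2 i + v1 i).
  move=> i; apply: spannedP; last first.
    by move: (v1P i); rewrite /= addnS addnA addrA addSn.
  by move: (v2P i); rewrite /= addnS addnCA addnA addrCA addrA addSn.
rewrite word_classBr.
rewrite (lbr_jacobi _ _ _ _ _ _ (piece_deg (word_class_spanned t)) (piece_deg (word_class_spanned u)) (piece_deg yP)).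
rewrite e1 e2 addrC -scaleNr scaler_sumr -big_split; apply: eq_bigr => i _.
by rewrite /= lbr_linr.
Qed.

Lemma free_decomp0 (s : seq int) (x : L) :
  spanned (fun t => (brackets t == 0%N) && (wdeg dg t \in s)) x ->
  exists c : I -> rat, x = \sum_(i <- gs) c i *: letter i.
Proof.
move=> [f fP ->]; move: f fP; apply: supp_in_ind => [|a t f tP [c e]].
  by exists (fun=> 0); rewrite linear0 big1 // => i _; rewrite scale0r.
case: t tP => // i _; exists (fun j => a * (j == i)%:R + c j).
rewrite fl_piP e.
have -> : a *: fl_pi dg (mono (Gen i)) = \sum_(j <- gs) (a * (j == i)%:R) *: letter j.
  rewrite (bigD1_seq i) //= eqxx mulr1 big1 ?addr0 // => j /negbTE ->.
  by rewrite mulr0 scale0r.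
by rewrite -big_split; apply: eq_bigr => j _; rewrite /= scalerDl.
Qed.

Lemma free_decompS n (s : seq int) (x : L) :
  spanned (fun t => (brackets t == n.+1) && (wdeg dg t \in s)) x ->
  exists2 u : I -> L,
    forall i, spanned (fun t => (brackets t == n) && (wdeg dg t + dg i \in s)) (u i) &
    x = \sum_(i <- gs) lbr (letter i) (u i).
Proof.
move=> [f fP ->]; move: f fP; apply: supp_in_ind => [|a t f tP [u uP e']].
  exists (fun=> 0); first by move=> i; apply: spanned0.
  by rewrite linear0 big1 // => i _; apply: (lin0 (lbr_linr _)).
case: t tP => // t1 t2 /= /andP[/eqP[bn] ds].
have [v vP e] := word_bracket_decomp t1 (word_class_spanned t2).
exists (fun i => a *: v i + u i).
  move=> i; apply: spannedP => //; apply: spannedS (vP i) => t /andP[/eqP -> /eqP ->].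
  by rewrite bn eqxx subrK.
rewrite fl_piP e' word_classBr e scaler_sumr -big_split; apply: eq_bigr => i _.
by rewrite /= lbr_linr.
Qed.

Lemma brcomp_lbr_cgen i (x : cfree dg) n :
  brcomp (lbr (cgen dg i) x) n = if n is m.+1 then lbr (letter i) (brcomp x m) else 0.
Proof.
rewrite /= /conv; case: n => [|n]; first by rewrite big_ord0.
rewrite big_ord_recl /= subn0 big1 ?addr0 // => k _.
exact: (lin0 (lbr_linl _)).
Qed.

(** The decomposition is made separately in each number of brackets; the pieces
have bounded degrees, hence they assemble to elements of the completion. *)
Lemma cfree_decomp (x : cfree dg) : exists (c : I -> rat) (u : I -> cfree dg),
  x = \sum_(i <- gs) (c i *: cgen dg i + lbr (cgen dg i) (u i)).
Proof.
have /asboolP[s sP] := brcompP x.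
have [c cE] := free_decomp0 (sP 0%N).
have /choice[u uP] : forall n, exists u : I -> L,
    (forall i, spanned (fun t => (brackets t == n) && (wdeg dg t + dg i \in s)) (u i)) /\
    brcomp x n.+1 = \sum_(i <- gs) lbr (letter i) (u i).
  by move=> n; have [u] := free_decompS (sP n.+1); exists u.
have ucf i : (fun n => u n i) \in @cfree_pred I dg.
  apply/asboolP; exists [seq d - dg i | d <- s] => n.
  apply: spannedS ((uP n).1 i) => t /andP[-> ds] /=.
  by apply/mapP; exists (wdeg dg t + dg i); rewrite ?addrK.
exists c, (fun i => CFree (ucf i)); apply: cfree_ext => n.
rewrite brcomp_sum; case: n => [|n].
  rewrite cE; apply: eq_bigr => i _.
  by rewrite brcompPl brcomp_lbr_cgen addr0.
rewrite (uP n).2; apply: eq_bigr => i _.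
by rewrite brcompPl brcomp_lbr_cgen /= scaler0 add0r.
Qed.

(** The argument by which linear maps out of the completion are determined by
the generators although the elements are infinite sums: [P n x] typically says that
some defect has order at least [n] at [x]. *)
Lemma cfree_induction (P : nat -> cfree dg -> Prop) :
  (forall n, P n 0) ->
  (forall n a x y, P n x -> P n y -> P n (a *: x + y)) ->
  (forall x, P 0%N x) ->
  (forall n i, P n (cgen dg i)) ->
  (forall n i x, P n x -> P n.+1 (lbr (cgen dg i) x)) ->
  forall n x, P n x.
Proof.
move=> Pz Plin P0 Pgen Pbr; elim=> [|n IH] x; first exact: P0.
have [c [u ->]] := cfree_decomp x.
elim/big_ind: _ => //= [y z Py Pz'|i _].
  by rewrite -[y]scale1r; apply: Plin.
by apply: Plin => //; apply/Pbr/IH.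
Qed.

End Decomposition.

(** * Completed free Lie algebras *)

Lemma fctPE (A : Type) (M : lmodType rat) a (f g : A -> M) x :
  (a *: f + g) x = a *: f x + g x.
Proof. by []. Qed.

Section Weight.
Variable M : lmodType rat.
Implicit Types x y : nat -> M.

(** The weight of a word is its number of letters, one more than its number of brackets,
so that weights add under the bracket. *)
Definition weight_fil (n : nat) x : Prop := forall k, (k.+1 < n)%N -> x k = 0.

Lemma weight_filP n a x y :
  weight_fil n x -> weight_fil n y -> weight_fil n (a *: x + y).
Proof. by move=> x0 y0 k kn; rewrite fctPE x0 // y0 // scaler0 addr0. Qed.

Lemma weight_filW n x : weight_fil n.+1 x -> weight_fil n x.
Proof. by move=> x0 k kn; apply: x0; apply: ltnW. Qed.

Lemma weight_fil_sep x : (forall n, weight_fil n x) -> x = 0.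
Proof. by move=> x0; apply/funext => k; apply: (x0 k.+2). Qed.

Definition weight_filtration : filtration (nat -> M) :=
  @Filtration (nat -> M) weight_fil (fun v k (h : (k.+1 < 0)%N) => ltac:(by []))
    (fun n k _ => erefl) weight_filP weight_filW weight_fil_sep.

(** A term [u m] of order [m] contributes to the component [k], of weight [k.+1],
only if [m < k.+2]. *)
Definition weight_limit (u : nat -> nat -> M) : nat -> M :=
  fun k => \sum_(m < k.+2) u m k.

Lemma weight_limitP (u : nat -> nat -> M) : (forall m, weight_fil m (u m)) ->
  converges weight_filtration u (weight_limit u).
Proof.
move=> Fu n k kn; rewrite addrfctE opprfctE fct_sumE /weight_limit.
rewrite (big_ord_widen n (fun m => u m k)) // big_mkcond; apply/eqP.
rewrite subr_eq0; apply/eqP/eq_bigr => m _; case: ltnP => // km.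
by rewrite Fu.
Qed.

Lemma weight_complete : complete_on weight_filtration (fun=> True).
Proof. by move=> u _ Fu; exists (weight_limit u) => //; apply: weight_limitP. Qed.

End Weight.

(** The bracket on the full product over the number of brackets.  This product is
complete, while [cfree] is complete in each degree only, and it therefore carries the
gauge action. *)
Section Convolution.
Variables (I : choiceType) (dg : I -> int).
Local Notation L := (freeLie dg).
Implicit Types x y z : nat -> L.

Lemma conv_linl z : linear (fun x => conv x z).
Proof.
move=> a x y; apply/funext => n; rewrite fctPE /conv.
rewrite scaler_sumr -big_split; apply: eq_bigr => i _.
by rewrite fctPE lbr_linl.
Qed.

Lemma conv_linr z : linear (conv z).
Proof.
move=> a x y; apply/funext => n; rewrite fctPE /conv.
rewrite scaler_sumr -big_split; apply: eq_bigr => i _.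
by rewrite fctPE lbr_linr.
Qed.

Lemma conv_weight m n x y :
  weight_fil m x -> weight_fil n y -> weight_fil (m + n) (conv x y).
Proof.
move=> x0 y0 k kmn; rewrite /conv big1 // => i _.
have [im|mi] := ltnP i.+1 m; first by rewrite x0 // (lin0 (lbr_linl _)).
rewrite y0 ?(lin0 (lbr_linr _)) //.
case: k i kmn mi => [[]//|k] [i ik] /= kmn mi.
rewrite -subSn // ltn_subLR ?leqW //.
rewrite -ltnS -addSn; apply: leq_trans kmn _; by rewrite leq_add2r.
Qed.

Lemma conv_raising x : raising (weight_filtration L) (conv x).
Proof. by move=> n v v0; apply: (@conv_weight 1 n) => // -[]. Qed.

Lemma conv_jacobi0 x y z : (forall n, hdeg 0 (x n)) -> (forall n, hdeg 0 (y n)) ->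
  conv (conv x y) z = conv x (conv y z) - conv y (conv x z).
Proof.
move=> x0 y0; apply/funext => n; rewrite addrfctE opprfctE conv_l !conv_r.
rewrite [X in _ - X]exchange_big -sumrB; apply: eq_bigr => p _ /=.
rewrite -sumrB; apply: eq_bigr => q _ /=.
rewrite [(q + p)%N]addnC -sumrB; apply: eq_bigr => r _ /=.
exact: lbr_jacobi0.
Qed.

End Convolution.

Section CompletedWeight.
Variables (I : choiceType) (dg : I -> int).
Implicit Types x y : cfree dg.

Lemma brcomp_lin : linear (@brcomp I dg).
Proof. by move=> a x y; apply/funext => n; rewrite brcompPl. Qed.

Lemma brcompB x y n : brcomp (x - y) n = brcomp x n - brcomp y n.
Proof. by rewrite (linB brcomp_lin). Qed.

Definition cfree_fil (n : nat) x : Prop := weight_fil n (brcomp x).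

Lemma cfree_fil_zero n : cfree_fil n 0.
Proof. by move=> k _; rewrite brcomp0. Qed.

Lemma cfree_filP n a x y : cfree_fil n x -> cfree_fil n y -> cfree_fil n (a *: x + y).
Proof. by move=> x0 y0; rewrite /cfree_fil brcomp_lin; apply: weight_filP. Qed.

Lemma cfree_filW n x : cfree_fil n.+1 x -> cfree_fil n x.
Proof. exact: weight_filW. Qed.

Lemma cfree_fil_sep x : (forall n, cfree_fil n x) -> x = 0.
Proof. by move=> x0; apply: cfree_ext => n; rewrite brcomp0 (x0 n.+2). Qed.

Definition cfree_filtration : filtration (cfree dg) :=
  @Filtration (cfree dg) cfree_fil (fun v k (h : (k.+1 < 0)%N) => ltac:(by []))
    cfree_fil_zero cfree_filP cfree_filW cfree_fil_sep.

Lemma cfree_complete d : complete_on cfree_filtration (hdeg d).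
Proof.
move=> u ud Fu; pose S := weight_limit (fun m => brcomp (u m)).
have Sd n : spanned (fun t => (brackets t == n) && (wdeg dg t == d)) (S n).
  by apply: spanned_sum => m _; apply: ud.
have Sc : S \in @cfree_pred I dg.
  apply/asboolP; exists [:: d] => n; apply: spannedS (Sd n) => t.
  by rewrite inE.
exists (CFree Sc); first exact: Sd.
move=> k; have := @weight_limitP _ _ Fu k.
by rewrite /= /cfree_fil (linB brcomp_lin) (lin_sum brcomp_lin).
Qed.

Lemma cfree_fil_lbr m n x y :
  cfree_fil m x -> cfree_fil n y -> cfree_fil (m + n) (lbr x y).
Proof. exact: conv_weight. Qed.

End CompletedWeight.

Section Universal.
Variables (I : choiceType) (dg : I -> int) (N : gradedLieType) (F : filtration N).
Variable h : I -> N.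
Hypothesis F_complete : forall d, complete_on F (hdeg d).
Hypothesis F_lbr : forall m n x y, F m x -> F n y -> F (m + n)%N (lbr x y).
Hypothesis h_deg : forall i, hdeg (dg i) (h i).
Hypothesis h_weight : forall i, F 1%N (h i).
Local Notation L := (freeLie dg).

(** The value of the extension at [x] is the sum over [m] of the images of the
components of [x].  The sum exists for homogeneous [x], where the target is complete,
and for all [x] by linearity; multiplicativity holds up to terms of large order
for partial sums, hence exactly. *)
Theorem cfree_universal : exists f : cfree dg -> N,
  [/\ glie_morphism f, forall i, f (cgen dg i) = h i &
      forall n x, cfree_fil n x -> F n (f x)].
Proof.
have [Phi [[Plin Pdeg Pbr] Pgen _]] := freeLie_universal h_deg.
have Pword t : F (brackets t).+1 (Phi (fl_pi dg (mono t))).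
  elim: t => [i|t IHt u IHu]; first by rewrite Pgen.
  by rewrite word_classBr Pbr /= -addnS -addSn; apply: F_lbr.
have Pfil n (Q : pred (word I)) x :
    spanned (fun t => (brackets t == n) && Q t) x -> F n.+1 (Phi x).
  move=> [f fP ->]; move: f fP; apply: supp_in_ind => [|a t f /andP[/eqP <- _] IH].
    by rewrite linear0 (lin0 Plin); apply: fil_zero.
  by rewrite fl_piP Plin; apply: filP.
have Pcomp (x : cfree dg) n : F n.+1 (Phi (brcomp x n)).
  by have /asboolP[s sP] := brcompP x; apply: Pfil (sP n).
pose R (x : cfree dg) := converges F (fun m => Phi (brcomp x m)).
have Rlin a x y u v : R x u -> R y v -> R (a *: x + y) (a *: u + v).
  move=> Rx Ry k; under eq_bigr => m _ do rewrite brcompPl Plin.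
  rewrite big_split -scaler_sumr opprD addrACA -scalerBr.
  by apply: filP; [apply: Rx | apply: Ry].
have Rhom d x : hdeg d x -> exists2 y, hdeg d y & R x y.
  move=> xd; apply: F_complete => m; last exact/filW/Pcomp.
  exact/Pdeg/cfree_deg_comp.
have Rex x : exists y, R x y.
  have [s [c [cP ->]]] := hdeg_span x.
  elim: s => [|d s [y Ry]].
    exists 0 => k; rewrite big_nil sub0r; apply/filN/fil_sum => m _.
    by rewrite brcomp0 (lin0 Plin); apply: fil_zero.
  have [z _ Rz] := Rhom _ _ (cP d).
  exists (1 *: z + y); rewrite big_cons -[c d]scale1r; exact: Rlin.
have [p pP] := choice Rex.
have Runiq x y : R x y -> p x = y by move=> Ry; apply: converges_uniq (pP x) Ry.
exists p; split.
- split=> [a x y|d x xd|x y].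
  + by apply: Runiq; apply: Rlin.
  + by have [y yd /Runiq ->] := Rhom _ _ xd.
  apply: Runiq => k.
  pose A := \sum_(i < k) Phi (brcomp x i); pose B := \sum_(j < k) Phi (brcomp y j).
  rewrite -[X in F k (X - _)](subrK (lbr A B)) -addrA; apply: filD.
    rewrite -[lbr (p x) _](subrK (lbr A (p y))) -addrA.
    rewrite -(linB (lbr_linl _)) -(linB (lbr_linr _)); apply: filD.
      rewrite -[k]addn0; apply: F_lbr; last exact: fil_all.
      exact: pP.
    by rewrite -[k]add0n; apply: F_lbr; [apply: fil_all | apply: pP].
  have -> : \sum_(m < k) Phi (brcomp (lbr x y) m) =
      \sum_(i < k) \sum_(j < k) \sum_(m < k | (i + j).+1 == m)
        Phi (lbr (brcomp x i) (brcomp y j)).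
    transitivity (\sum_(m < k) \sum_(i < k) \sum_(j < k | (i + j).+1 == m)
        Phi (lbr (brcomp x i) (brcomp y j))).
      apply: eq_bigr => m _.
      rewrite /= /conv (conv_sum (fun i j => lbr (brcomp x i) (brcomp y j)) (ltnW (ltn_ord m))).
      rewrite (lin_sum Plin); apply: eq_bigr => i _.
      by rewrite (lin_sum Plin).
    rewrite exchange_big; apply: eq_bigr => i _.
    by rewrite (exchange_big_dep predT).
  rewrite (lin_sum (lbr_linl _)) -sumrB; apply: fil_sum => i _.
  rewrite (lin_sum (lbr_linr _)) -sumrB; apply: fil_sum => j _.
  have [ijk|kij] := ltnP (i + j).+1 k.
    rewrite (big_pred1 (Ordinal ijk)) => [|m]; last by rewrite eq_sym.
    by rewrite Pbr subrr; apply: fil_zero.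
  rewrite big_pred0 => [|m]; last first.
    by apply/negbTE; rewrite neq_ltn (leq_trans (ltn_ord m) kij) orbT.
  rewrite subr0; apply: (fil_le (n := (i.+1 + j.+1)%N)); last exact: F_lbr.
  by rewrite addSn addnS; apply: leqW.
- move=> i; apply: Runiq => -[|k]; first exact: fil_all.
  rewrite big_ord_recl big1 => [|m _]; last by rewrite (lin0 Plin).
  by rewrite addr0 /= Pgen subrr; apply: fil_zero.
move=> n x x0; rewrite -[p x](subrK (\sum_(m < n) Phi (brcomp x m))).
apply: filD; first exact: pP.
apply: fil_sum => m _; case: (ltnP m.+1 n) => mn; last exact: fil_le mn (Pcomp x m).
by rewrite x0 // (lin0 Plin); apply: fil_zero.
Qed.

End Universal.

(** * The Baker-Campbell-Hausdorff series *)

(** Series with the commutator as bracket, concentrated in degree 0, as a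
target for [cfree_universal]. *)
Definition commLie (T : eqType) : Type := ncseries T.

HB.instance Definition _ (T : eqType) := GRing.Lmodule.copy (commLie T) (ncseries T).

Section CommutatorLie.
Variable T : eqType.
Local Notation A := (commLie T).
Implicit Types (x y z : A).

Definition comm_deg (d : int) x : Prop := d = 0 \/ x = 0.

Lemma comm_deg0 d : comm_deg d 0. Proof. by right. Qed.

Lemma comm_degP d a x y : comm_deg d x -> comm_deg d y -> comm_deg d (a *: x + y).
Proof.
by move=> [->|->] [e|->]; rewrite ?scaler0 ?addr0 ?e; [left|left|left|right].
Qed.

Lemma comm_deg_span x : exists (s : seq int) (c : int -> A),
  (forall d, comm_deg d (c d)) /\ x = \sum_(d <- s) c d.
Proof.
exists [:: 0], (fun d => if d == 0 then x else 0); split; last by rewrite big_seq1.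
by move=> d; case: eqP => [->|_]; [left|right].
Qed.

Lemma comm_deg_indep (s : seq int) (c : int -> A) : uniq s ->
  (forall d, comm_deg d (c d)) -> \sum_(d <- s) c d = 0 ->
  forall d, d \in s -> c d = 0.
Proof.
move=> us cP cs d ds; have [d0|//] := cP d.
rewrite (bigD1_seq d) //= big1 ?addr0 // in cs => e; rewrite d0.
by have [->|//] := cP e; rewrite eqxx.
Qed.

Lemma comm_linl z : linear (fun x : A => sad x z : A).
Proof. by move=> a x y; rewrite /sad smulPl smulPr opprD addrACA -scalerBr. Qed.

Lemma comm_linr x : linear (fun y : A => sad x y : A).
Proof. exact: sad_lin. Qed.

Lemma comm_deg_br i j x y : comm_deg i x -> comm_deg j y -> comm_deg (i + j) (sad x y : A).
Proof.
move=> [->|->]; last by right; apply: (lin0 (comm_linl y)).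
by rewrite add0r => -[->|->]; [left|right; apply: (lin0 (comm_linr x))].
Qed.

Lemma comm_anti i j x y : comm_deg i x -> comm_deg j y ->
  sad y x = - ((-1) ^ (i * j) *: (sad x y : A)) :> A.
Proof.
move=> [->|->] _; first by rewrite mul0r expr0z scale1r /sad opprB.
by rewrite (lin0 (comm_linl y)) scaler0 oppr0 (lin0 (comm_linr y)).
Qed.

Lemma comm_jacobi i j k x y z : comm_deg i x -> comm_deg j y -> comm_deg k z ->
  sad (sad x y) z = sad x (sad y z) - (-1) ^ (i * j) *: (sad y (sad x z) : A) :> A.
Proof.
move=> [->|->] _ _; last first.
  have ad0 u : sad 0 u = 0 := lin0 (comm_linl u).
  by rewrite !ad0 (lin0 (comm_linr y)) scaler0 subr0.
rewrite mul0r expr0z scale1r /sad !(linB (smul_linl _)) !(linB (smul_linr _)) !smulA.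
rewrite !opprB [RHS]addrACA !subrKA [RHS]addrACA [LHS]addrACA; congr (_ + _).
exact: addrC.
Qed.

HB.instance Definition _ := Lmodule_isGradedLie.Build A
  comm_deg0 comm_degP comm_deg_span comm_deg_indep
  comm_linl comm_linr comm_deg_br comm_anti comm_jacobi.

End CommutatorLie.

Section Series.
Local Notation L := (cfree (fun _ : bool => 0%:Z)).
Local Notation x := (cgen (fun _ : bool => 0%:Z) false).
Local Notation y := (cgen (fun _ : bool => 0%:Z) true).
Local Notation beta i := (bernoulli i / i`!%:R).

Lemma bool_deg0 n (z : L) :
  spanned (fun t : word bool => (brackets t == n) && (wdeg (fun=> 0%:Z) t == 0)) (brcomp z n).
Proof.
have w0 (t : word bool) : wdeg (fun=> 0%:Z) t = 0 by elim: t => //= t -> u ->.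
have /asboolP[s sP] := brcompP z.
by apply: spannedS (sP n) => t /andP[-> _]; rewrite w0 eqxx.
Qed.

Lemma bool_cfree (z : nat -> freeLie (fun _ : bool => 0%:Z)) :
  (forall n, spanned (fun t => (brackets t == n) && (wdeg (fun=> 0%:Z) t == 0)) (z n)) ->
  z \in @cfree_pred bool (fun=> 0%:Z).
Proof.
move=> zP; apply/asboolP; exists [:: 0] => n; apply: spannedS (zP n) => t.
by rewrite inE.
Qed.

(** With [E] the multiplication by the weight, [z] is a fixed point of the step if and
only if [E z = [z, y] + sum_i B_i / i! (ad z)^i (x + y)].  The component with [n] brackets of
the sum involves only the terms with at most [n] brackets, and only components of [z] with
fewer than [n] brackets. *)
Lemma bch_step_proof (z : L) :
  (fun n => n.+1%:R^-1 *: (\sum_(i < n.+1) beta i *: brcomp (iter i (lbr z) (x + y)) n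
     + brcomp (lbr z y) n)) \in @cfree_pred bool (fun=> 0%:Z).
Proof.
apply: bool_cfree => n; rewrite -[X in spanned _ X]addr0; apply: spannedP; last exact: spanned0.
rewrite -[X in spanned _ (X + _)]scale1r; apply: spannedP; last exact: bool_deg0.
apply: spanned_sum => i _; rewrite -[X in spanned _ X]addr0; apply: spannedP; last exact: spanned0.
exact: bool_deg0.
Qed.

Definition bch_step (z : L) : L := CFree (bch_step_proof z).

Lemma cfree_fil1 (I : choiceType) (dg : I -> int) (z : cfree dg) : cfree_fil 1 z.
Proof. by []. Qed.

Lemma lbr_raising (I : choiceType) (dg : I -> int) (z : cfree dg) :
  raising (cfree_filtration dg) (lbr z).
Proof. by move=> n u; apply: (@cfree_fil_lbr _ _ 1 n). Qed.

Lemma bch_step_contracts n (z z' : L) :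
  cfree_fil n (z - z') -> cfree_fil n.+1 (bch_step z - bch_step z').
Proof.
move=> zz'.
have lbrF u u' : cfree_fil n.+1 (u - u') -> cfree_fil n.+1 (lbr z u - lbr z' u').
  move=> uu'; rewrite -[lbr z u](subrK (lbr z' u)) -addrA.
  rewrite -(linB (lbr_linl _)) -(linB (lbr_linr _)); apply: (filD (F := cfree_filtration _)).
    by rewrite -addn1; apply: cfree_fil_lbr.
  by apply/filW/lbr_raising.
have itF i : cfree_fil n.+1 (iter i (lbr z) (x + y) - iter i (lbr z') (x + y)).
  elim: i => [|i IH]; last exact: lbrF.
  by rewrite subrr; apply: cfree_fil_zero.
move=> k kn; rewrite brcompB /= -scalerBr opprD addrACA -sumrB big1 ?add0r.
  have := lbrF y y; rewrite subrr => /(_ (@cfree_fil_zero _ _ _)) /(_ k kn).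
  by rewrite brcompB => ->; rewrite scaler0.
by move=> i _; rewrite -scalerBr -brcompB itF ?scaler0.
Qed.

(** Successive iterates of the step agree to larger and larger order, so their
components stabilize. *)
Lemma bch_fixpoint : exists z, bch_step z = z.
Proof.
pose zs k := iter k bch_step 0.
have zsF k : cfree_fil k.+1 (zs k.+1 - zs k).
  by elim: k => [|k IH]; [apply: cfree_fil1 | apply: bch_step_contracts].
have lt k m : (k <= m)%N -> cfree_fil k.+1 (zs m - zs k).
  move/subnKC <-; elim: (m - k)%N => [|j IH].
    by rewrite addn0 subrr; apply: cfree_fil_zero.
  rewrite addnS -[zs _.+1](subrK (zs (k + j)%N)) -addrA; apply: (filD (F := cfree_filtration _)) => //.
  apply: (fil_le (F := cfree_filtration _)) (zsF (k + j)%N).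
  by rewrite ltnS leq_addr.
have zc : (fun n => brcomp (zs n.+1) n) \in @cfree_pred bool (fun=> 0%:Z).
  by apply: bool_cfree => n; apply: bool_deg0.
pose z : L := CFree zc.
have zF k : cfree_fil k.+1 (z - zs k).
  move=> n nk; have := lt n.+1 k nk n (ltnSn _); rewrite !brcompB.
  by move/eqP; rewrite subr_eq0 => /eqP ->; rewrite -[brcomp z n]/(brcomp (zs n.+1) n) subrr.
exists z; apply: (fil_eq (F := cfree_filtration _)) => k.
apply: (fil_le (n := k.+2)); first by rewrite !leqW.
rewrite -[bch_step z](subrK (zs k.+1)) -addrA; apply: filD.
  exact: bch_step_contracts.
rewrite -opprB; apply: filN; exact: (zF k.+1).
Qed.


Lemma bernoulli0 : bernoulli 0 = 1.
Proof. by have := bernoulli_rec 0; rewrite big_ord1 !divr1. Qed.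

Lemma bernoulli1 : bernoulli 1 = - 2^-1.
Proof.
have := bernoulli_rec 1; rewrite big_ord_recr big_ord1 /= bernoulli0 !divr1 mul1r.
by move/eqP; rewrite addrC addr_eq0 => /eqP.
Qed.

Lemma brcomp_lbr (I : choiceType) (dg : I -> int) (u v : cfree dg) n :
  brcomp (lbr u v) n = \sum_(i < n) lbr (brcomp u i) (brcomp v (n.-1 - i)%N).
Proof. by []. Qed.

(** The recursion is unrolled three times, with [B_0 = 1] and [B_1 = - 1/2]; the term
of [B_2] vanishes because it brackets [x + y] with itself. *)
Lemma bch_low_order (z : L) : bch_step z = z ->
  cfree_fil 4 (z - (x + y + 2^-1 *: lbr x y
              + 12^-1 *: lbr x (lbr x y) - 12^-1 *: lbr y (lbr x y))).
Proof.
move=> ze.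
pose X := brcomp x 0; pose Y := brcomp y 0.
have hX : hdeg 0 X by apply: cfree_deg_comp => n; apply: bool_deg0.
have hY : hdeg 0 Y by apply: cfree_deg_comp => n; apply: bool_deg0.
have zE n : brcomp z n = n.+1%:R^-1 *: (\sum_(i < n.+1) beta i *: brcomp (iter i (lbr z) (x + y)) n
     + brcomp (lbr z y) n) by rewrite -{1}ze.
have xyE n : brcomp (x + y) n = if n is 0%N then X + Y else 0.
  by rewrite (linD (@brcomp_lin _ _)) addrfctE; case: n => // n; apply: addr0.
have XY0 : lbr (X + Y) (X + Y) = 0 by apply: lbr00; rewrite -[X]scale1r; apply: hdegP.
have z0 : brcomp z 0 = X + Y.
  rewrite zE big_ord1 brcomp_lbr big_ord0 addr0 bernoulli0 divr1 invr1 !scale1r.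
  exact: xyE.
have br1 (u v : L) : brcomp (lbr u v) 1 = lbr (brcomp u 0) (brcomp v 0).
  by rewrite brcomp_lbr big_ord1.
have br0 (u v : L) : brcomp (lbr u v) 0 = 0 by rewrite brcomp_lbr big_ord0.
have br2 (u v : L) : brcomp (lbr u v) 2 =
    lbr (brcomp u 0) (brcomp v 1) + lbr (brcomp u 1) (brcomp v 0).
  by rewrite brcomp_lbr big_ord_recr big_ord1.
have z1 : brcomp z 1 = 2^-1 *: lbr X Y.
  have -> : brcomp z 1 = 2^-1 *: (beta 0 *: brcomp (x + y) 1
      + beta 1 *: brcomp (lbr z (x + y)) 1 + brcomp (lbr z y) 1).
    by rewrite zE big_ord_recr big_ord1.
  rewrite !br1 !xyE z0 XY0 !scaler0 !add0r (linD (lbr_linl Y)).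
  by rewrite (lbr00 hY) addr0.
have z2 : brcomp z 2 = 12^-1 *: lbr X (lbr X Y) - 12^-1 *: lbr Y (lbr X Y).
  have -> : brcomp z 2 = 3^-1 *: (beta 0 *: brcomp (x + y) 2
      + beta 1 *: brcomp (lbr z (x + y)) 2
      + beta 2 *: brcomp (lbr z (lbr z (x + y))) 2 + brcomp (lbr z y) 2).
    by rewrite zE 2!big_ord_recr big_ord1.
  have hW : hdeg 0 (lbr X Y) by apply: (hdeg_br _ _ _ _ hX hY).
  have y1 : brcomp y 1 = 0 by [].
  rewrite !br2 !br1 br0 !xyE -/Y z0 z1 XY0 y1 !(lin0 (lbr_linr _)) !scaler0 !addr0 !add0r.
  rewrite (linZ (lbr_linl _)) (linD (lbr_linr _)) (linZ (lbr_linl _)).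
  rewrite (lbr_anti0 hX hW) (lbr_anti0 hY hW) bernoulli1.
  set P := lbr X _; set Q := lbr Y _.
  rewrite scaler0 addr0 -opprD scalerN -!scaleNr !scalerDr !scalerA scalerN -scaleNr.
  by rewrite -addrA -scalerDl; congr (_ *: _ + _ *: _); apply/eqP.
have brD (u v : L) n : brcomp (u + v) n = brcomp u n + brcomp v n.
  by rewrite (linD (@brcomp_lin _ _)).
have brZ a (u : L) n : brcomp (a *: u) n = a *: brcomp u n.
  by rewrite (linZ (@brcomp_lin _ _)).
have lt0 i n : brcomp (cgen (fun=> 0%:Z) i : L) n.+1 = 0 by [].
have l0 (u : freeLie (fun _ : bool => 0%:Z)) : lbr 0 u = 0 := lin0 (lbr_linl u).
have r0 (u : freeLie (fun _ : bool => 0%:Z)) : lbr u 0 = 0 := lin0 (lbr_linr u).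
move=> [|[|[|n]]] // _; rewrite brcompB; apply/eqP; rewrite subr_eq0 brcompB !brD !brZ ?z0 ?z1 ?z2
  ?br0 ?br1 ?br2 ?br0 ?br1 ?lt0 ?l0 ?r0
  ?scaler0 ?addr0 ?add0r ?subr0 //.
by rewrite scaler0 add0r.
Qed.

End Series.

Section Series.
Local Notation L := (cfree (fun _ : bool => 0%:Z)).
Local Notation x := (cgen (fun _ : bool => 0%:Z) false).
Local Notation y := (cgen (fun _ : bool => 0%:Z) true).
Local Notation beta i := (bernoulli i / i`!%:R).
Local Notation len := (length_filtration bool).

Lemma bool_all : forall i : bool, i \in [:: false; true].
Proof. by case. Qed.

Lemma iota_exists : exists iota : L -> ncseries bool,
  [/\ linear iota,
      forall u v, iota (lbr u v) = sad (iota u) (iota v),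
      forall i, iota (cgen _ i) = sletter i &
      forall n u, cfree_fil n u -> len n (iota u)].
Proof.
have lenC d : complete_on (len : filtration (commLie bool)) (hdeg d).
  move=> u ud Fu; have [S _ cS] := length_complete (fun=> I) Fu.
  have [d0|d0] := eqVneq d 0; first by exists S => //; left.
  have u0 m : u m = 0 by have [/eqP|//] := ud m; rewrite (negbTE d0).
  exists 0; first by right.
  by move=> k; rewrite big1 ?subr0 //; apply: fil_zero.
have lenB m n (u v : commLie bool) : len_fil m u -> len_fil n v -> len_fil (m + n) (lbr u v).
  move=> Fu Fv; apply: (filB (F := len)); first exact: len_fil_smul.
  by rewrite addnC; apply: len_fil_smul.
have hd i : hdeg ((fun _ : bool => 0%:Z) i) (sletter i : commLie bool) by left.
have hw i : len_fil 1 (sletter i : commLie bool) by case.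
have [iota [[il _ ib] ig iF]] := cfree_universal (F := len : filtration (commLie bool)) lenC lenB hd hw.
by exists iota.
Qed.

(** The counterpart among Lie series of the Euler derivation: multiplication by the
weight. *)
Lemma euler_proof (z : L) :
  (fun n => n.+1%:R *: brcomp z n) \in @cfree_pred bool (fun=> 0%:Z).
Proof.
apply: bool_cfree => n; rewrite -[X in spanned _ X]addr0.
by apply: spannedP; [apply: bool_deg0 | apply: spanned0].
Qed.

Definition euler (z : L) : L := CFree (euler_proof z).

Lemma eulerE z n : brcomp (euler z) n = n.+1%:R *: brcomp z n.
Proof. by []. Qed.

Lemma euler_lin : linear euler.
Proof.
move=> a u v; apply: cfree_ext => n; rewrite brcompPl !eulerE brcompPl.
by rewrite scalerDr !scalerA mulrC.
Qed.

Lemma euler_lbr u v :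
  euler (lbr u v) = lbr (euler u) v + lbr u (euler v).
Proof.
apply: cfree_ext => n; rewrite (linD (@brcomp_lin _ _)) addrfctE /= /conv.
rewrite scaler_sumr -big_split; apply: eq_bigr => -[i /= lt] _.
rewrite (linZ (lbr_linl _)) (linZ (lbr_linr _)) -scalerDl -natrD.
by case: n lt => // n lt; rewrite addSn addnS subnKC.
Qed.

Lemma euler_cgen i : euler (cgen _ i) = cgen _ i.
Proof. by apply: cfree_ext => -[|n] /=; rewrite ?scale1r ?scaler0. Qed.

Lemma seuler_sad (T : eqType) (s r : ncseries T) :
  seuler (sad s r) = sad (seuler s) r + sad s (seuler r).
Proof.
rewrite /sad (linB (@seuler_lin _)) !seuler_smul [smul (seuler r) s + _]addrC.
by rewrite opprD addrACA.
Qed.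

Section Iota.
Variable iota : L -> ncseries bool.
Hypotheses (iota_lin : linear iota)
  (iota_lbr : forall u v, iota (lbr u v) = sad (iota u) (iota v))
  (iota_gen : forall i, iota (cgen _ i) = sletter i).

Lemma iota_nil u : iota u [::] = 0.
Proof.
apply: (cfree_induction (gs := [:: false; true]) (dg := fun=> 0%:Z)
  (P := fun n u => if n is 0%N then True else iota u [::] = 0) _ _ _ _ _ _ _ 1) => //.
- exact: bool_all.
- by case=> // n; rewrite (lin0 iota_lin).
- by case=> // n a u1 u2 e1 e2; rewrite iota_lin ncPE e1 e2 mulr0 addr0.
- by case=> // n i; rewrite iota_gen.
move=> n i u1 _; rewrite iota_lbr /sad addrfctE opprfctE !smul_nil.
by rewrite mulrC subrr.
Qed.

(** Both sides are derivations along [iota] that agree on the generators. *)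
Lemma seuler_iota u : seuler (iota u) = iota (euler u).
Proof.
apply: (fil_eq (F := len)) => n; move: n u.
have D0 i : seuler (iota (cgen _ i)) - iota (euler (cgen _ i)) = 0.
  rewrite euler_cgen iota_gen; apply/eqP; rewrite subr_eq0; apply/eqP/funext => w.
  rewrite /seuler /sletter; case: eqP => [->|_]; last by rewrite mulr0.
  by rewrite mul1r.
apply: (cfree_induction (gs := [:: false; true]) (dg := fun=> 0%:Z)) => //.
- exact: bool_all.
- move=> n; rewrite (lin0 euler_lin) (lin0 iota_lin) (lin0 (@seuler_lin _)) subrr.
  exact: fil_zero.
- move=> n a u v Fu Fv; rewrite euler_lin !iota_lin seuler_lin opprD addrACA -scalerBr.
  exact: filP.
- by move=> n i; rewrite D0; apply: fil_zero.
move=> n i u Fu; rewrite euler_lbr (linD iota_lin) !iota_lbr euler_cgen.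
rewrite seuler_sad.
have -> : seuler (iota (cgen _ i)) = iota (cgen _ i).
  by apply/eqP; rewrite -subr_eq0 -{2}[cgen _ i]euler_cgen D0.
rewrite opprD addrACA subrr add0r -(linB (sad_lin _)); apply: sad_raising => //.
exact: iota_nil.
Qed.

End Iota.

Lemma sexp_nil (T : eqType) (W : ncseries T) : sexp W [::] = 1.
Proof. by rewrite /sexp big_ord1 /= /sone invr1 mulr1. Qed.

(** [seuler_sexp] for [W] a letter: the two equations are the cases [(a, b) = (0, W)] and
[(a, b) = (- W, 0)], in which the series in Bernoulli numbers reduces to one term. *)
Lemma seuler_sexp_letter (i : bool) :
  seuler (sexp (sletter i)) = smul (sexp (sletter i)) (sletter i) /\
  seuler (sexp (sletter i)) = smul (sletter i) (sexp (sletter i)).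
Proof.
have eul : seuler (sletter i) = sletter i.
  apply/funext => w; rewrite /seuler /sletter; case: eqP => [->|_]; last by rewrite mulr0.
  by rewrite mul1r.
have adv : sad (sletter i) (sletter i) = 0 by rewrite /sad subrr.
have ser : converges len (fun k => beta k *: iter k (sad (sletter i)) (sletter i)) (sletter i).
  case=> [|k]; first exact: fil_all.
  rewrite big_ord_recl bernoulli0 divr1 scale1r big1 ?addr0 ?subrr; first exact: fil_zero.
  move=> j _; rewrite lift0 iterSr adv.
  by rewrite (_ : iter _ _ 0 = 0) ?scaler0 //; elim: (j : nat) => //= m ->; apply: (lin0 (sad_lin _)).
have s0 : sletter i [::] = 0 by [].
split.
  rewrite (@seuler_sexp _ _ s0 0 (sletter i)) ?subr0 ?eul ?adv ?subr0 //.
  by rewrite (lin0 (smul_linl _)) subr0.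
rewrite (@seuler_sexp _ _ s0 (- sletter i) 0).
  by rewrite (lin0 (smul_linr _)) sub0r (linN (smul_linl _)) opprK.
by rewrite sub0r opprK eul (lin0 (sad_lin _)) subr0.
Qed.

(** The equation expresses [E f] on words of length [n] through values of [f] on
shorter words, and [E] is injective on series without constant term. *)
Lemma seuler_eq_uniq (f g : ncseries bool) (a b : ncseries bool) :
  a [::] = 0 -> b [::] = 0 -> f [::] = g [::] ->
  seuler f = smul f b - smul a f -> seuler g = smul g b - smul a g -> f = g.
Proof.
move=> a0 b0 fg ef eg; apply: (fil_eq (F := len)).
have eD : seuler (f - g) = smul (f - g) b - smul a (f - g).
  rewrite (linB (@seuler_lin _)) ef eg (linB (smul_linl _)) (linB (smul_linr _)).
  by rewrite [in LHS]opprB [in RHS]opprB addrACA [RHS]addrACA [- _ + _]addrC.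
elim=> [|n IH]; first exact: fil_all.
have lF : len_fil n.+1 (seuler (f - g)).
  rewrite eD; apply: (filB (F := len)).
    by rewrite -addn1; apply: len_fil_smul IH (len_fil1 b0).
  by apply: (@len_fil_smul _ 1 n) IH; apply: len_fil1.
move=> [|i w] wn; first by rewrite addrfctE opprfctE fg subrr.
have /eqP := lF _ wn; rewrite /seuler mulf_eq0 Num.Theory.pnatr_eq0 /=.
by move/eqP.
Qed.

(** The fixed point of [bch_step] is carried by [iota] to a series [W] for which
[exp W] and [exp x exp y] solve the same differential equation. *)
Theorem bch_exists : exists2 z : L, bch_series z &
  cfree_fil 4 (z - (x + y + 2^-1 *: lbr x y
              + 12^-1 *: lbr x (lbr x y) - 12^-1 *: lbr y (lbr x y))).
Proof.
have [z ze] := bch_fixpoint; exists z; last exact: bch_low_order.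
have [iota [il ib ig iF]] := iota_exists.
exists iota; split=> //.
have z0 := iota_nil il ib ig z.
have ser : converges (cfree_filtration (fun _ : bool => 0%:Z))
    (fun i => beta i *: iter i (lbr z) (x + y)) (euler z - lbr z y).
  move=> k n nk; rewrite !brcompB brcomp_sum.
  have -> : brcomp (euler z) n = \sum_(i < n.+1) beta i *: brcomp (iter i (lbr z) (x + y)) n
     + brcomp (lbr z y) n.
    rewrite -{1}ze /euler /= scalerA divff ?scale1r //.
    by rewrite Num.Theory.pnatr_eq0.
  rewrite addrK (big_ord_widen k (fun i => beta i *: brcomp (iter i (lbr z) (x + y)) n) (ltnW nk)).
  rewrite big_mkcond -sumrB big1 // => i _.
  rewrite (linZ (@brcomp_lin _ _)) scalrfctE; case: ltnP => ni; first by rewrite subrr.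
  have it m : cfree_fil m.+1 (iter m (lbr z) (x + y)).
    by elim: m => [|m IH]; [apply: cfree_fil1 | apply: lbr_raising].
  by rewrite it // scaler0 subrr.
have ad i u : iota (iter i (lbr z) u) = iter i (sad (iota z)) (iota u).
  by elim: i => //= i IH; rewrite ib IH.
have eW : seuler (sexp (iota z)) =
    smul (sexp (iota z)) (sletter true) - smul (- sletter false) (sexp (iota z)).
  apply: seuler_sexp => // k; have := @converges_map _ _ (cfree_filtration _) len _ _ _ il iF ser k.
  rewrite (linB il) ib -seuler_iota // ig.
  under eq_bigr => j _ do rewrite (linZ il) ad (linD il) !ig.
  by rewrite opprK [sletter true + _]addrC.
apply: (@seuler_eq_uniq _ _ (- sletter false) (sletter true)) => //.
  by rewrite smul_nil !sexp_nil mulr1.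
rewrite seuler_smul (seuler_sexp_letter true).1 (seuler_sexp_letter false).2.
by rewrite (linN (smul_linl _)) opprK -!smulA addrC.
Qed.

End Series.

(** * Composition of intervals *)

Lemma subrACA (U : zmodType) (p q r s : U) : p - q - (r - s) = p - r - (q - s).
Proof. by rewrite !opprD addrACA. Qed.

Section GaugeAction.
Variables (I : choiceType) (dg : I -> int) (d : cfree dg -> cfree dg).
Hypothesis dP : dgla_differential d.
Local Notation V := (nat -> freeLie dg).
Local Notation F := (weight_filtration (freeLie dg)).
Local Notation F' := (ext_filtration F).
Implicit Types (c e a b : cfree dg).

(** The adjoint action of [c], extended to the adjoined differential, whose bracket
with [c] is [- d c]. *)
Definition gauge_act c : V * rat^o -> V * rat^o :=
  gauge_op (conv (brcomp c)) (brcomp (d c)).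

Lemma gauge_act_lin c : linear (gauge_act c).
Proof. exact: gauge_op_lin (conv_linr (brcomp c)). Qed.

Lemma gauge_act_raising c : raising F' (gauge_act c).
Proof. exact: gauge_op_raising (@conv_raising _ _ (brcomp c)). Qed.

Lemma d_lin : linear d. Proof. by case: dP. Qed.

Lemma gauge_act_linl q : linear (gauge_act^~ q).
Proof.
move=> a c c'; rewrite /gauge_act /gauge_op d_lin !brcomp_lin (conv_linl q.1).
rewrite [RHS]surjective_pairing; congr (_, _) => /=; last by rewrite scaler0 addr0.
by rewrite scalerDr opprD addrACA !scalerA [q.2 * a]mulrC -scalerA -scalerBr.
Qed.

(** On the full product this is the Jacobi identity; on the adjoined
differential it is the derivation rule for [d]. *)
Lemma gauge_act_lbr c c' q : hdeg 0 c -> hdeg 0 c' ->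
  gauge_act (lbr c c') q = gauge_act c (gauge_act c' q) - gauge_act c' (gauge_act c q).
Proof.
move=> c0 c'0; have [_ ddeg _ dder] := dP.
rewrite [RHS]surjective_pairing; congr (_, _).
rewrite -[RHS]/(conv (brcomp c) (conv (brcomp c') q.1 - q.2 *: brcomp (d c')) - 0 *: brcomp (d c)
  - (conv (brcomp c') (conv (brcomp c) q.1 - q.2 *: brcomp (d c)) - 0 *: brcomp (d c'))).
rewrite !scale0r !subr0 !(linB (conv_linr _)) !(linZ (conv_linr _)).
rewrite (dder _ _ _ _ c0 c'0) expr0z scale1r (linD (@brcomp_lin _ _)).
have -> : lbr (d c) c' = - lbr c' (d c).
  by rewrite (lbr_anti _ _ _ _ c'0 (ddeg _ _ c0)) mul0r expr0z scale1r.
rewrite (linN (@brcomp_lin _ _)) /= conv_jacobi0; last by move=> n; apply: cfree_deg_comp.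
  by rewrite [RHS]subrACA [- _ + _]addrC scalerBr.
by move=> n; apply: cfree_deg_comp.
Qed.

(** Convergence in each component and convergence for the filtration agree when
the terms have increasing order. *)
Lemma sums_toP (u : nat -> cfree dg) s : (forall i, cfree_fil i (u i)) ->
  sums_to u s <-> converges (cfree_filtration dg) u s.
Proof.
move=> Fu; split=> [su k n nk|cu n]; last first.
  exists n.+2 => m nm; apply/eqP; rewrite eq_sym -subr_eq0 -brcompB.
  by apply/eqP/(cu m).
have [N NP] := su n; rewrite brcompB -(NP (maxn N k)) ?leq_maxl //.
rewrite !brcomp_sum [X in _ - X](big_ord_widen (maxn N k) (fun m => brcomp (u m) n)) ?leq_maxr //.
rewrite [X in _ - X]big_mkcond -sumrB big1 // => m _; case: ltnP => km; first by rewrite subrr.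
by rewrite subr0 (Fu m n) // (leq_trans nk).
Qed.

Lemma iter_lbr_fil c b i : cfree_fil i (iter i (lbr c) b).
Proof. exact: (raising_iter (F := cfree_filtration dg) _ _ (lbr_raising c)). Qed.

Lemma interval_differentialP e a b : interval_differential d e a b <->
  converges (cfree_filtration dg)
    (fun i => (bernoulli i / i`!%:R) *: iter i (lbr e) (b - a)) (d e - lbr e b).
Proof.
apply: sums_toP => i; apply: (filZ (F := cfree_filtration dg)); exact: iter_lbr_fil.
Qed.

Theorem interval_gauge e a b : interval_differential d e a b <->
  exp_maps F' (gauge_act e) (brcomp b, 1) (brcomp a, 1).
Proof.
rewrite interval_differentialP.
rewrite (gaugeP (F := F) _ (conv_linr (brcomp e)) (@conv_raising _ _ (brcomp e)) (@weight_complete _)).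
have it i : brcomp (iter i (lbr e) (b - a)) = iter i (conv (brcomp e)) (brcomp b - brcomp a).
  elim: i => [|i IH]; first exact: (linB (@brcomp_lin _ _)).
  by rewrite [RHS]/= -IH.
have E k : brcomp (d e - lbr e b - \sum_(m < k) (bernoulli m / m`!%:R) *: iter m (lbr e) (b - a))
  = brcomp (d e) - conv (brcomp e) (brcomp b) -
     \sum_(m < k) (bernoulli m / m`!%:R) *: iter m (conv (brcomp e)) (brcomp b - brcomp a).
  rewrite !(linB (@brcomp_lin _ _)) (lin_sum (@brcomp_lin _ _)); congr (_ - _).
  by apply: eq_bigr => m _; rewrite (linZ (@brcomp_lin _ _)) it.
by split=> cv k; have := cv k; rewrite /= /cfree_fil E.
Qed.

Section Representation.
Local Notation dg0 := (fun _ : bool => 0%:Z).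
Variables (iota : cfree dg0 -> ncseries bool) (phi : cfree dg0 -> cfree dg).
Hypotheses (iota_lin : linear iota)
  (iota_lbr : forall u v, iota (lbr u v) = sad (iota u) (iota v))
  (iota_gen : forall i, iota (cgen _ i) = sletter i)
  (phiP : glie_morphism phi).
Variable ev : ncseries bool -> V * rat^o -> V * rat^o.
Hypothesis evE : is_eval (fun i => gauge_act (phi (cgen _ i))) ev.

(** Substitution followed by [iota] and the gauge action of [phi u] are both Lie maps
to operators and agree on generators.  For the induction the defect is measured by
how much it raises the order of its argument [p]: the defect at a
bracket involves the defect at the image of [p] under a generator. *)
Lemma eval_iota u : ev (iota u) = gauge_act (phi u).
Proof.
have [phi_lin phi_deg phi_lbr] := phiP.
pose op (i : bool) := gauge_act (phi (cgen dg0 i)).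
have opl i : linear (op i) by apply: gauge_act_lin.
have opr i : raising F' (op i) by apply: gauge_act_raising.
have evl q : linear (ev^~ q) := eval_linearl opl opr evE q.
apply/funext => q; apply: (fil_eq (F := F')) => n.
suff: forall n u k p, F' k p -> F' (n + k)%N (ev (iota u) p - gauge_act (phi u) p).
  by move/(_ n u 0%N q (fil_all _ _)); rewrite addn0.
move=> {}n {}u.
apply: (@cfree_induction _ dg0 [:: false; true] erefl bool_all
  (fun n u => forall k p, F' k p -> F' (n + k)%N (ev (iota u) p - gauge_act (phi u) p))).
- move=> m k p _; rewrite (lin0 iota_lin) (lin0 phi_lin) (lin0 (evl p)) (lin0 (gauge_act_linl p)) subrr.
  exact: fil_zero.
- move=> m a v w Fv Fw k p Fp.
  rewrite iota_lin phi_lin evl gauge_act_linl opprD addrACA -scalerBr.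
  by apply: filP; [apply: Fv | apply: Fw].
- move=> v k p Fp; apply: filB.
    exact: (eval_fil opr evE (m := 0)).
  by rewrite add0n; apply/filW/gauge_act_raising.
- move=> m i k p _; rewrite iota_gen (eval_letter opl opr evE) subrr.
  exact: fil_zero.
move=> m i v IH k p Fp.
rewrite iota_lbr /sad (linB (evl p)) !(eval_mul opl opr evE) iota_gen !(eval_letter opl opr evE).
have hd w : hdeg 0 (phi w) by apply: phi_deg => l; apply: bool_deg0.
rewrite phi_lbr gauge_act_lbr // opprB addrACA [X in _ + X]addrC.
set g := gauge_act (phi (cgen _ i)).
have gl : linear g by apply: gauge_act_lin.
rewrite addrACA -[op i]/g -(linB gl); apply: filD.
  by rewrite addSn; apply/(opr i)/IH.
rewrite -opprB addSnnS; apply/filN/IH.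
exact: opr.
Qed.

End Representation.

Theorem interval_differential_BCH (e1 e2 z a b c : cfree dg) :
  is_BCH e1 e2 z -> interval_differential d e1 a b ->
  interval_differential d e2 b c -> interval_differential d z a c.
Proof.
move=> [s [iota [il ib ix iy es]] [phi [phiP <- <- <-]]].
rewrite !interval_gauge => ab bc.
pose op (i : bool) := gauge_act (phi (cgen (fun=> 0%:Z) i)).
have opl i : linear (op i) by apply: gauge_act_lin.
have opr i : raising F' (op i) by apply: gauge_act_raising.
have [ev evE] := eval_exists opl opr (ext_complete (@weight_complete _)).
have ig i : iota (cgen _ i) = sletter i by case: i.
have evx := converges_uniq (exp_maps_letter opl opr evE false _) ab.
have evy := converges_uniq (exp_maps_letter opl opr evE true _) bc.
have := eval_sexp opl opr evE (brcomp c, 1) (iota_nil il ib ig s).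
by rewrite es (eval_mul opl opr evE) evy evx (eval_iota il ib ig phiP evE).
Qed.

(** The sign in the derivation rule depends on the first argument alone, so the
second one may have several degrees. *)
Lemma derivation_lbr i x y : hdeg i x ->
  d (lbr x y) = lbr (d x) y + (-1) ^ i *: lbr x (d y).
Proof.
have [dl _ _ dder] := dP => xi.
have [s [u [uP ->]]] := hdeg_span y.
rewrite (lin_sum (lbr_linr x)) !(lin_sum dl) !(lin_sum (lbr_linr _)).
rewrite scaler_sumr -big_split; apply: eq_bigr => j _.
exact: (dder _ _ _ _ xi (uP j)).
Qed.

End GaugeAction.

Lemma cgen_deg (I : choiceType) (dg : I -> int) i : hdeg (dg i) (cgen dg i).
Proof.
move=> [|n] /=; last exact: spanned0.
by exists (mono (Gen i)) => //; apply: supp_inU; rewrite /= !eqxx.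
Qed.

Theorem theorem2
  (dA : cfree degA -> cfree degA) (dB : cfree degB -> cfree degB) :
  let a0 := cgen degA A_a0 in
  let a2 := cgen degA A_a2 in
  let e := cgen degA A_e in
  let b0 := cgen degB B_a0 in
  let b1 := cgen degB B_a1 in
  let b2 := cgen degB B_a2 in
  let e1 := cgen degB B_e1 in
  let e2 := cgen degB B_e2 in
  dgla_differential dA ->
  dA a0 = - (2^-1 *: lbr a0 a0) ->
  dA a2 = - (2^-1 *: lbr a2 a2) ->
  interval_differential dA e a0 a2 ->
  dgla_differential dB ->
  dB b0 = - (2^-1 *: lbr b0 b0) ->
  dB b1 = - (2^-1 *: lbr b1 b1) ->
  dB b2 = - (2^-1 *: lbr b2 b2) ->
  interval_differential dB e1 b0 b1 ->
  interval_differential dB e2 b1 b2 ->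
  exists p : cfree degA -> cfree degB,
    [/\ dgla_morphism dA dB p,
        p a0 = b0,
        p a2 = b2,
        is_BCH e1 e2 (p e)
      & forall n, (n < 3)%N ->
        brcomp (p e) n =
        brcomp (e1 + e2 + 2^-1 *: lbr e1 e2
              + 12^-1 *: lbr e1 (lbr e1 e2) - 12^-1 *: lbr e2 (lbr e1 e2)) n].
Proof.
move=> a0 a2 e b0 b1 b2 e1 e2 dAP dAa0 dAa2 dAe dBP dBb0 _ dBb2 dBe1 dBe2.
have [s sBCH s_low] := bch_exists.
pose h (i : bool) := if i then e2 else e1.
have h_deg i : hdeg ((fun _ : bool => 0%:Z) i) (h i) by case: i; [apply: (cgen_deg degB B_e2) | apply: (cgen_deg degB B_e1)].
have [phi [phiP phi_gen phi_fil]] := cfree_universal (F := cfree_filtration degB)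
  (@cfree_complete _ _) (@cfree_fil_lbr _ _) h_deg (fun=> cfree_fil1 _).
have [phi_lin phi_deg phi_lbr] := phiP.
have zBCH : is_BCH e1 e2 (phi s).
  by exists s => //; exists phi; split; rewrite ?phi_gen.
pose k i := match i with A_a0 => b0 | A_a2 => b2 | A_e => phi s end.
have k_deg i : hdeg (degA i) (k i).
  case: i; [exact: (cgen_deg degB B_a0) | exact: (cgen_deg degB B_a2) |].
  by apply: phi_deg => n; apply: bool_deg0.
have [p [pP p_gen p_fil]] := cfree_universal (F := cfree_filtration degB)
  (@cfree_complete _ _) (@cfree_fil_lbr _ _) k_deg (fun=> cfree_fil1 _).
have [p_lin p_deg p_lbr] := pP.
have [[dAl _ _ _] [dBl _ _ _]] := (dAP, dBP).
exists p; split; rewrite ?p_gen //; last first.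
  move=> n n3; apply/eqP; rewrite -subr_eq0 -brcompB.
  have := phi_fil _ _ s_low n; rewrite ltnS => /(_ n3) <-; apply/eqP; congr (brcomp _ n).
  rewrite !(linB phi_lin) !(linD phi_lin) !(linZ phi_lin) !phi_lbr !phi_gen.
  by [].
split=> // x; apply: (fil_eq (F := cfree_filtration degB)) => n; move: n x.
have D0 i : p (dA (cgen _ i)) = dB (p (cgen _ i)).
  rewrite p_gen; case: i.
  - by rewrite dAa0 dBb0 (linN p_lin) (linZ p_lin) p_lbr p_gen.
  - by rewrite dAa2 dBb2 (linN p_lin) (linZ p_lin) p_lbr p_gen.
  (* On [e], both sides minus the bracket of [phi s] with [b2] are the sum of the
     interval series of [phi s]. *)
  apply: (addIr (- lbr (phi s) b2)).
  have /interval_differentialP cB := interval_differential_BCH dBP zBCH dBe1 dBe2.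
  move/interval_differentialP: dAe => cA.
  apply: (converges_uniq (F := cfree_filtration degB)) cB => m.
  have := @converges_map _ _ (cfree_filtration _) (cfree_filtration _) _ _ _ p_lin p_fil cA m.
  rewrite (linB p_lin) p_lbr !p_gen.
  have it j u : p (iter j (lbr e) u) = iter j (lbr (phi s)) (p u).
    by elim: j => //= j IH; rewrite p_lbr p_gen IH.
  by under eq_bigr => j _ do rewrite (linZ p_lin) it (linB p_lin) !p_gen.
apply: (@cfree_induction _ degA [:: A_a0; A_a2; A_e] erefl) => //.
- by case.
- move=> n; rewrite (lin0 dAl) (lin0 p_lin) (lin0 dBl) subrr; exact: cfree_fil_zero.
- move=> n a x y Fx Fy; rewrite dAl !p_lin dBl opprD addrACA -scalerBr.
  exact: cfree_filP.
- move=> n i; rewrite D0 subrr; exact: cfree_fil_zero.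
move=> n i x Fx.
rewrite (derivation_lbr dAP _ (cgen_deg _ i)) (linD p_lin) (linZ p_lin) !p_lbr.
rewrite (derivation_lbr dBP _ (p_deg _ _ (cgen_deg _ i))) D0.
rewrite opprD addrACA subrr add0r -scalerBr -(linB (lbr_linr _)).
by apply: (filZ (F := cfree_filtration degB)); apply: lbr_raising.
Qed.
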